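(* Let $d>1$, let $\{f_n\}_{n\ge 1}$ be a $d$-decaying Gauss like iterated function system on $[0,1]$, and let $\{a_n(x)\}_{n\ge1}$ denote the digits of $x$ in this system. Let $m\ge1$ be an integer and let $t_0,\dots,t_m$ be non-negative real numbers with $t_0\ne0$ and $t_i\neq 0$ for at least one $1\le i\le m$. Put $$\Lambda=\{x\in(0,1):\ a_n(x)\le a_{n+1}(x)\ \text{ for all } n\ge1\},$$ $$R_n(x)=\frac{\log\big(a_n(x)^{t_0}a_{n+1}(x)^{t_1}\cdots a_{n+m}(x)^{t_m}\big)}{\log n}\qquad(n\ge2),$$ and, for $0\le\alpha\le\infty$, $$E(\Lambda,\alpha,\{t_i\}_{0\le i\le m})=\Big\{x\in\Lambda:\ \liminf_{n\to\infty}R_n(x)=\alpha\Big\},$$ $$F(\Lambda,\alpha,\{t_i\}_{0\le i\le m})=\Big\{x\in\Lambda:\ \lim_{n\to\infty}R_n(x)=\alpha\Big\},$$ $$G(\Lambda,\alpha,\{t_i\}_{0\le i\le m})=\Big\{x\in\Lambda:\ \limsup_{n\to\infty}R_n(x)=\alpha\Big\}.$$ Then for every $0\le\alpha\le\infty$, $$\dim_{\rm H}F(\Lambda,\alpha,\{t_i\}_{0\le i\le m})=\dim_{\rm H}G(\Lambda,\alpha,\{t_i\}_{0\le i\le m})=\dim_{\rm H}E(\Lambda,\alpha,\{t_i\}_{0\le i\le m}),$$ where $\dim_{\rm H}$ denotes Hausdorff dimension.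
   Context: $\mathbb{N}=\{1,2,3,\dots\}$. Let $d>1$. A sequence $\{f_n\}_{n\ge1}$ of $C^1$ functions $f_n:[0,1]\to[0,1]$ is a $d$-decaying Gauss like iterated function system if: (i) (open set condition) $f_i((0,1))\cap f_j((0,1))=\emptyset$ for all $i\ne j$ in $\mathbb{N}$; (ii) (contraction) there exist $q\in\mathbb{N}$ and $0<\rho<1$ such that $0<|(f_{a_1}\circ\cdots\circ f_{a_q})'(x)|\le\rho<1$ for all $(a_1,\dots,a_q)\in\mathbb{N}^q$ and $x\in[0,1]$; (iii) (regularity) for every $\varepsilon>0$ there are constants $C_1=C_1(\varepsilon)>0$, $C_2=C_2(\varepsilon)>0$ such that for each $i\in\mathbb{N}$ there are constants $\xi_i,\lambda_i$ with $\xi_i\le|f_i'(x)|\le\lambda_i$ for all $x\in[0,1]$ and $\frac{C_1}{i^{d+\varepsilon}}\le\xi_i\le\lambda_i\le\frac{C_2}{i^{d-\varepsilon}}$; (iv) $\bigcup_{i=1}^\infty f_i([0,1])=(0,1]$, and $f_i(x)<f_j(x)$ whenever $i>j$; (v) (bounded distortion) there is $\kappa\ge1$ such that for every $n\in\mathbb{N}$ and $(a_1,\dots,a_n)\in\mathbb{N}^n$, $|(f_{a_1}\circ\cdots\circ f_{a_n})'(x)|\le\kappa\,|(f_{a_1}\circ\cdots\circ f_{a_n})'(y)|$ for all $x,y\in[0,1]$. Digits: for $\underline a=\{a_n\}_{n\ge1}\in\mathbb{N}^{\mathbb{N}}$ put $\Pi(\underline a)=\lim_{n\to\infty}f_{a_1}\circ\cdots\circ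 f_{a_n}(1)$. For all but countably many $x\in(0,1)$ there is exactly one $\underline a\in\mathbb{N}^{\mathbb{N}}$ with $\Pi(\underline a)=x$; its entries are the digits of $x$, written $a_n(x)$. Sets defined by digits are understood to consist of such points $x$ only (countable sets do not affect Hausdorff dimension). Convention: the empty set has Hausdorff dimension $0$. *)

(* Defs.v *)
From HB Require Import structures.
From mathcomp Require Import all_boot all_order all_algebra.
From mathcomp Require Import all_classical all_reals all_analysis.

Set Implicit Arguments.
Unset Strict Implicit.
Unset Printing Implicit Defensive.

Import Order.TTheory GRing.Theory Num.Theory.
Import numFieldNormedType.Exports.

Local Open Scope classical_set_scope.
Local Open Scope ring_scope.

(* The index set {1, 2, 3, ...} is represented by the nonzero elements of nat;
   the value f 0 of a system f : nat -> R -> R is never used. *)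

Section Derivative.
Context {R : realType}.
Implicit Types (A : set R) (f : R -> R) (x : R).

(* On a closed interval, these derivatives are one-sided at the endpoints, so
   that the values of f outside of A do not matter. *)
Definition diff_quotient f x : R -> R := fun y => (f y - f x) / (y - x).

Definition derivable_within A f x : Prop :=
  cvg (diff_quotient f x @ within A x^').

Definition derive_within A f x : R :=
  lim (diff_quotient f x @ within A x^').

Definition C1_on A f : Prop :=
  (forall x, A x -> derivable_within A f x) /\
  {within A, continuous (derive_within A f)}.

End Derivative.

Section HausdorffDimension.
Context {R : realType}.
Local Open Scope ereal_scope.
Implicit Types (A U : set R) (s delta : R).

(* diam set0 = -oo; the empty set is treated separately in diam_pow. *)
Definition diam U : \bar R :=
  ereal_sup [set `|x - y|%:E | x in U & y in U].

Definition diam_pow s U : \bar R :=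
  if U == set0 then 0 else diam U `^ s.

Definition hausdorff_premeasure s delta A : \bar R :=
  ereal_inf [set \sum_(k <oo) diam_pow s (U k) |
    U in [set U : nat -> set R |
            A `<=` \bigcup_k U k /\ forall k, diam (U k) <= delta%:E]].

Definition hausdorff_measure s A : \bar R :=
  ereal_sup [set hausdorff_premeasure s delta A |
    delta in [set e : R | (0 < e)%R]].

Definition hausdorff_dim A : \bar R :=
  ereal_inf [set s%:E | s in [set s : R | (0 <= s)%R /\ hausdorff_measure s A = 0]].

End HausdorffDimension.

Section GaussLikeIFS.
Context {R : realType}.
Implicit Types (f : nat -> R -> R) (w : seq nat) (a : nat -> nat) (x d : R).

Definition compw f w : R -> R := foldr (fun i g => f i \o g) idfun w.

Definition positive_word w : bool := all (fun i => (0 < i)%N) w.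

Record gauss_like_ifs d f : Prop := GaussLikeIFS {
  gl_maps : forall i, (0 < i)%N -> f i @` `[0, 1] `<=` `[0, 1];
  gl_C1 : forall i, (0 < i)%N -> C1_on `[0, 1] (f i);
  gl_open_set : forall i j, (0 < i)%N -> (0 < j)%N -> i <> j ->
    f i @` `]0, 1[ `&` f j @` `]0, 1[ = set0;
  gl_contraction : exists (q : nat) (rho : R),
    [/\ (0 < q)%N, 0 < rho, rho < 1 &
      forall w, size w = q -> positive_word w -> forall x, x \in `[0, 1] ->
        0 < `|derive_within `[0, 1] (compw f w) x| <= rho];
  gl_regularity : forall eps : R, 0 < eps -> exists C1 C2 : R,
    [/\ 0 < C1, 0 < C2 &
      forall i, (0 < i)%N -> exists xi lambda : R,
        (forall x, x \in `[0, 1] ->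
           xi <= `|derive_within `[0, 1] (f i) x| <= lambda) /\
        [/\ C1 / i%:R `^ (d + eps) <= xi, xi <= lambda &
            lambda <= C2 / i%:R `^ (d - eps)]];
  gl_cover : \bigcup_(i in [set i | (0 < i)%N]) (f i @` `[0, 1]) =
    `]0, 1]%classic;
  gl_order : forall i j, (0 < i)%N -> (0 < j)%N -> (j < i)%N ->
    forall x, x \in `[0, 1] -> f i x < f j x;
  gl_distortion : exists kappa : R, 1 <= kappa /\
    forall w, (0 < size w)%N -> positive_word w ->
      forall x y : R, x \in `[0, 1] -> y \in `[0, 1] ->
        `|derive_within `[0, 1] (compw f w) x| <=
          kappa * `|derive_within `[0, 1] (compw f w) y|
}.

(* Sequences of digits are stored from index 0: a k is the (k+1)-st digit. *)
Definition coding_map f a : R := limn (fun n => compw f (mkseq a n) 1).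

Definition codes f x : set (nat -> nat) :=
  [set a | (forall k, (0 < a k)%N) /\ coding_map f a = x].

Definition uniquely_coded f : set R :=
  [set x | 0 < x < 1 /\ exists! a, codes f x a].

(* a_n(x) for n >= 1, meaningful for x in uniquely_coded f; the default
   sequence given to xget is irrelevant there. *)
Definition digit f (n : nat) x : nat := xget (fun=> 1%N) (codes f x) n.-1.

Definition Lambda f : set R :=
  [set x | uniquely_coded f x /\
    forall n, (1 <= n)%N -> (digit f n x <= digit f n.+1 x)%N].

(* ln 0 = ln 1 = 0 here, so the terms of index n = 0, 1 are 0. *)
Definition log_ratio f (m : nat) (t : 'I_m.+1 -> R) x (n : nat) : R :=
  ln (\prod_(i < m.+1) (digit f (n + i) x)%:R `^ t i) / ln n%:R.

Definition E_set f (A : set R) (alpha : \bar R) m (t : 'I_m.+1 -> R) : set R :=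
  [set x | A x /\ limn_einf (fun n => (log_ratio f t x n)%:E) = alpha].

Definition F_set f (A : set R) (alpha : \bar R) m (t : 'I_m.+1 -> R) : set R :=
  [set x | A x /\ (fun n => (log_ratio f t x n)%:E) @ \oo --> alpha].

Definition G_set f (A : set R) (alpha : \bar R) m (t : 'I_m.+1 -> R) : set R :=
  [set x | A x /\ limn_esup (fun n => (log_ratio f t x n)%:E) = alpha].

End GaussLikeIFS.

(* Main.v *)
(* Let [T] be the sum of the [t i], [be = alpha / T] and
   [s0 = max 0 (1 - 1 / be) / d] (so [s0 = 1 / d] if [alpha = +oo]).
   Since the digits are nondecreasing, [R_n] lies between
   [T * log a_n / log n] and [T * log a_(n+m) / log n], so the [t i] enter only
   through [T].  The sets [E] and [G] both contain [F] and are contained in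
   [U = {liminf R_n <= alpha}]; it is enough to show that [U] is null in every
   dimension above [s0] and that [F] is not null in any dimension below [s0].

   Upper bound: up to countably many points, the digits of a point of [U] tend
   to infinity and satisfy [a_n <= n ^ B] for infinitely many [n], for any
   [B > be].  If [q j] bounds the [s]-th power of the contraction ratio of
   [f j], the generating function of complete symmetric polynomials bounds the
   total weight of nondecreasing words of length [n] with digits in [[L, M]] by
   [2 ^- n * exp (4 * \sum_(L <= j <= M) q j)].  With [M = n ^ B] and [s > s0] the
   exponent is [o(n)], so these cylinders form covers of vanishing [s]-sum.

   Lower bound: [F] contains all points whose [k]-th digit is [X_k + 2 b] with
   [b < N_k], where [N_k] is about [k ^ (be - 1)] (or [4 ^ k]) and
   [X_(k+1) = X_k + 2 N_k].  Writing [y] in [[0, 1[] as a Cantor series with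
   bases [N_k] parametrizes these points, and the inverse of this
   parametrization is [s]-Hoelder for every [s < s0]. *)
Require Import Defs.
From mathcomp Require Import all_boot all_order all_algebra.
From mathcomp Require Import all_classical all_reals all_analysis.
From mathcomp Require Import ring lra zify.
Import Order.TTheory GRing.Theory Num.Theory.
Import numFieldNormedType.Exports.
Local Open Scope classical_set_scope.
Local Open Scope ring_scope.

Set Implicit Arguments.
Unset Strict Implicit.

(** * Distance bounds from one-sided derivatives *)

Section OneSidedDerivatives.
Context {R : realType}.
Implicit Types (A : set R) (f : R -> R).

(** Near [x] the difference quotient is at most [|l| + 1] in absolute value, with [l] its limit
    along [A]; this bounds [|f x - f y|] by a multiple of [|x - y|]. *)
Lemma C1_on_continuous A f :
  (forall x, A x -> derivable_within A f x) -> {within A, continuous f}.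
Proof.
move=> df; apply/subspace_continuousP => x Ax.
apply/cvgrPdist_le => e e0.
have /cvg_ex[/= l] := df x Ax.
move=> /cvgrPdist_le /(_ 1 ltr01).
rewrite near_withinE near_withinE !near_simpl => -[r /= r0 rP].
have l0 : 0 < `|l| + 1 by rewrite ltr_wpDl.
near=> y => Ay; rewrite -![from_subspace _ _ _]/(f _).
have [->|yx] := eqVneq y x; first by rewrite subrr normr0 ltW.
have xyr : `|x - y| < r by near: y; apply: nbhsx_ballx.
have := rP y xyr yx Ay; rewrite /diff_quotient => lq.
have yx0 : y - x != 0 by rewrite subr_eq0.
have -> : f x - f y = - ((f y - f x) / (y - x)) * (y - x).
  by rewrite mulNr divfK// opprB.
rewrite normrM normrN.
have q : `|(f y - f x) / (y - x)| <= `|l| + 1.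
  by rewrite -lerBlDl; apply: le_trans lq; rewrite distrC; exact: lerB_dist.
apply: (@le_trans _ _ ((`|l| + 1) * `|y - x|)); first by rewrite ler_wpM2r.
rewrite mulrC -ler_pdivlMr// distrC.
near: y; apply: filterS (nbhsx_ballx x (e / (`|l| + 1)) (divr_gt0 e0 l0)) => y.
exact: ltW.
Unshelve. all: by end_near. Qed.

(** Inside [A] the one-sided limit is a full one, so the usual derivative, and with it the mean
    value theorem, becomes available. *)
Lemma derivable_within_is_derive A f (x : R) : nbhs x A ->
  derivable_within A f x -> is_derive x 1 f (derive_within A f x).
Proof.
move=> nA df.
have dl : diff_quotient f x @ within A x^' --> derive_within A f x by exact: df.
set l := derive_within A f x in dl *.
have h : h^-1 *: ((f \o shift x) (h *: (1:R)) - f x) @[h --> 0^'] --> l.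
  apply/cvgrPdist_le => e e0.
  move/cvgrPdist_le : dl => /(_ e e0).
  rewrite near_withinE near_withinE !near_simpl => dl.
  have [r /= r0 rP] : nbhs x (fun y => y != x -> `|l - diff_quotient f x y| <= e).
    by near=> y => yx; move: yx; near: y; apply: filterS2 nA dl => y Ay /[apply]; apply.
  near=> h.
  have h0 : h != 0 by near: h; exact: nbhs_dnbhs_neq.
  have := rP (h + x).
  rewrite /diff_quotient /= addrK scaler1 mulrC; apply; last first.
    by rewrite -subr_eq0 addrK.
  rewrite opprD addrCA subrr addr0 normrN.
  by near: h; apply: dnbhs0_lt.
by apply: DeriveDef; [apply/cvg_ex; exists l | exact: cvg_lim].
Unshelve. all: by end_near. Qed.

(** Mean value theorem. The rest of the proof uses the derivatives of the [f i] only through such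
    ratios of distances and through continuity. *)
Lemma C1_on_dist_bounds f (c C : R) : C1_on `[0, 1] f ->
  (forall x, x \in `[0, 1] -> c <= `|derive_within `[0, 1] f x| <= C) ->
  forall u v, u \in `[0, 1] -> v \in `[0, 1] ->
    c * `|u - v| <= `|f u - f v| <= C * `|u - v|.
Proof.
move=> [df _] cC.
suff H u v : u \in `[0, 1] -> v \in `[0, 1] -> u < v ->
    c * `|u - v| <= `|f u - f v| <= C * `|u - v|.
  move=> u v u01 v01; have [uv|vu|->] := ltgtP u v; first exact: H.
  - by rewrite (distrC u) (distrC (f u)); exact: H.
  - by rewrite !subrr normr0 !mulr0 lexx.
rewrite !in_itv/= => /andP[u0 u1] /andP[v0 v1] uv.
have [|x|w] := @MVT R f (derive_within `[0, 1] f) u v uv.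
- move=> x; rewrite in_itv/= => /andP[ux xv].
  apply: derivable_within_is_derive; last first.
    by apply: df; rewrite /= in_itv/=; apply/andP; split; lra.
  have : nbhs x `]0, 1[%classic.
    by apply: near_in_itvoo; rewrite in_itv/=; apply/andP; split; lra.
  by apply: filterS => y /=; rewrite !in_itv/= => /andP[/ltW -> /ltW ->].
- apply: (continuous_subspaceW _ (C1_on_continuous df)).
  by move=> y /=; rewrite !in_itv/= => /andP[? ?]; apply/andP; split; lra.
move=> + fE; rewrite in_itv/= => /andP[uw wv].
have /cC/andP[cw Cw] : w \in `[0, 1] by rewrite in_itv/=; apply/andP; split; lra.
by rewrite (distrC u) (distrC (f u)) fE normrM !ler_wpM2r.
Qed.

End OneSidedDerivatives.

Lemma lipschitz_within_continuous (R : realType) (A : set R) (g : R -> R) K :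
  (forall u v, A u -> A v -> `|g u - g v| <= K * `|u - v|) ->
  {within A, continuous g}.
Proof.
move=> gK; apply/subspace_continuousP => x Ax.
apply/cvgrPdist_le => e e0.
have K0 : 0 < `|K| + 1 by rewrite ltr_wpDl.
rewrite !near_withinE; near=> y => Ay; rewrite -![from_subspace _ _ _]/(g _).
apply: (le_trans (gK _ _ Ax Ay)).
apply: (@le_trans _ _ ((`|K| + 1) * `|x - y|)).
  by rewrite ler_wpM2r// (le_trans (ler_norm _))// lerDl.
rewrite mulrC -ler_pdivlMr//; near: y.
by apply: filterS (nbhsx_ballx x (e / (`|K| + 1)) (divr_gt0 e0 K0)) => y; exact: ltW.
Unshelve. all: by end_near. Qed.

(** A continuous injection of an interval is strictly monotone. *)
Lemma continuous_inj_not_extremum (R : realType) (g : R -> R) (p : R) :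
  {within `[0, 1], continuous g} -> {in `[0, 1] &, injective g} -> 0 < p < 1 ->
  ~ (forall u, u \in `[0, 1] -> g u <= g p) /\
  ~ (forall u, u \in `[0, 1] -> g p <= g u).
Proof.
move=> cg ig /andP[p0 p1].
have i0 : (0 : R) \in `[0, 1] by rewrite in_itv/= lexx ler01.
have i1 : (1 : R) \in `[0, 1] by rewrite in_itv/= lexx ler01.
have ip : p \in `[0, 1] by rewrite in_itv/= !ltW.
have [mg|mg] := itv_continuous_inj_mono cg ig.
- have l1 := mg _ _ i0 ip p0; have l2 := mg _ _ ip i1 p1.
  by split => H; [have := H _ i1|have := H _ i0]; rewrite leNgt (l1,l2).
- have l1 := mg _ _ ip i0 p0; have l2 := mg _ _ i1 ip p1.
  by split => H; [have := H _ i0|have := H _ i1]; rewrite leNgt (l1,l2).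
Qed.

Lemma mkseqD T (a : nat -> T) n k :
  mkseq a (n + k) = mkseq a n ++ mkseq (fun i => a (n + i)%N) k.
Proof. by rewrite /mkseq iotaD map_cat add0n -[in iota n k](addn0 n) iotaDl -map_comp. Qed.

(** * Cylinders, codings and their uniqueness *)

Section IFS.
Context {R : realType}.
Variables (d : R) (f : nat -> R -> R).
Hypothesis hf : gauss_like_ifs d f.

Lemma ifs_dist_bounds (eps : R) : 0 < eps -> exists C1 C2 : R,
  [/\ 0 < C1, 0 < C2 & forall i, (0 < i)%N -> forall u v,
    u \in `[0, 1] -> v \in `[0, 1] ->
    C1 / i%:R `^ (d + eps) * `|u - v| <= `|f i u - f i v|
      <= C2 / i%:R `^ (d - eps) * `|u - v|].
Proof.
move=> /(gl_regularity hf)[C1 [C2 [C10 C20 C12]]].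
exists C1, C2; split => // i i0 u v u01 v01.
have [xi [la [H [xi1 _ la2]]]] := C12 i i0.
have /andP[h1 h2] := C1_on_dist_bounds (gl_C1 hf i0) H u01 v01.
by apply/andP; split; [apply: le_trans h1 | apply: (le_trans h2)]; rewrite ler_wpM2r.
Qed.

Lemma ifs_inj i : (0 < i)%N -> {in `[0, 1] &, injective (f i)}.
Proof.
move=> i0 u v u01 v01 fuv.
have [C1 [C2 [C10 _ /(_ i i0 u v u01 v01)/andP[+ _]]]] := ifs_dist_bounds ltr01.
rewrite fuv subrr normr0 pmulr_rle0; last by rewrite divr_gt0// powR_gt0// ltr0n.
by rewrite normr_le0 subr_eq0 => /eqP.
Qed.

Lemma ifs_continuous i : (0 < i)%N -> {within `[0, 1], continuous (f i)}.
Proof. by move=> i0; apply: C1_on_continuous; case: (gl_C1 hf i0). Qed.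

Lemma ifs_range i u : (0 < i)%N -> u \in `[0, 1] -> 0 < f i u <= 1.
Proof.
move=> i0 u01; have : (\bigcup_(i in [set i | (0 < i)%N]) (f i @` `[0, 1])) (f i u).
  by exists i => //; exists u.
by rewrite (gl_cover hf) /= in_itv.
Qed.

Lemma ifs_in i u : (0 < i)%N -> u \in `[0, 1] -> f i u \in `[0, 1].
Proof. by move=> i0 /(ifs_range i0) /andP[/ltW ? ?]; rewrite in_itv/=; apply/andP. Qed.

(* If [f i p > f l q], moving [p] and [q] linearly to [1/2] reverses the
   inequality, so the images of the open interval meet on the way. *)
Lemma ifs_order i l p q : (0 < l)%N -> (l < i)%N ->
  p \in `[0, 1] -> q \in `[0, 1] -> f i p <= f l q.
Proof.
move=> l0 li; have i0 := leq_ltn_trans (leq0n l) li.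
rewrite !in_itv/= => /andP[p0 p1] /andP[q0 q1]; rewrite leNgt; apply/negP => pq.
pose mid (z t : R) := z + t * (2^-1 - z).
have mid01 z t : 0 <= z <= 1 -> 0 <= t <= 1 -> mid z t \in `[0, 1].
  move=> /andP[z0 z1] /andP[t0 t1]; rewrite in_itv /mid /=; apply/andP; split; nra.
pose h (t : R) := f i (mid p t) - f l (mid q t).
have [C1 [C2 [C10 C20 C12]]] := ifs_dist_bounds ltr01.
have hcont : {within `[0, 1], continuous h}.
  apply: (@lipschitz_within_continuous _ _ _
    (C2 / i%:R `^ (d - 1) * `|2^-1 - p| + C2 / l%:R `^ (d - 1) * `|2^-1 - q|)).
  move=> u v /=; rewrite !in_itv/= => u01 v01.
  have -> : h u - h v = (f i (mid p u) - f i (mid p v)) -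
     (f l (mid q u) - f l (mid q v)) by rewrite /h; ring.
  apply: (le_trans (ler_normB _ _)); rewrite mulrDl lerD//.
    have /andP[_] := C12 i i0 (mid p u) (mid p v) (mid01 _ _ (introT andP (conj p0 p1)) u01) (mid01 _ _ (introT andP (conj p0 p1)) v01).
    have -> : mid p u - mid p v = (2^-1 - p) * (u - v) by rewrite /mid; ring.
    by rewrite normrM mulrA.
  have /andP[_] := C12 l l0 (mid q u) (mid q v) (mid01 _ _ (introT andP (conj q0 q1)) u01) (mid01 _ _ (introT andP (conj q0 q1)) v01).
  have -> : mid q u - mid q v = (2^-1 - q) * (u - v) by rewrite /mid; ring.
  by rewrite normrM mulrA.
have h0 : 0 < h 0 by rewrite /h /mid !mul0r !addr0 subr_gt0.
have h1 : h 1 < 0.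
  rewrite /h /mid !mul1r !(addrC _ (_ - _)) !subrK subr_lt0.
  by apply: (gl_order hf) => //; rewrite in_itv/=; apply/andP; split; lra.
have [|t] := IVT ler01 hcont (v := 0); first by rewrite ge_min le_max (ltW h1) (ltW h0) orbT.
rewrite in_itv/= => /andP[t0 t1] ht.
have {}t0 : 0 < t.
  by rewrite lt_neqAle t0 andbT; apply/eqP => t0'; rewrite -t0' in ht; lra.
have il : i <> l by move=> e; rewrite e ltnn in li.
have /seteqP[+ _] := gl_open_set hf i0 l0 il.
move=> /(_ (f i (mid p t))); apply; split.
  by exists (mid p t) => //=; rewrite in_itv/= /mid; apply/andP; split; nra.
exists (mid q t); first by rewrite /= in_itv/= /mid; apply/andP; split; nra.
by move: ht; rewrite /h => /eqP; rewrite subr_eq0 => /eqP.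
Qed.

(** By [ifs_order] the common value would be the minimum of [f i] if [i < j] and its maximum if
    [j < i], but [p] is interior. *)
Lemma ifs_eq_digit i j p q : (0 < i)%N -> (0 < j)%N ->
  0 < p < 1 -> q \in `[0, 1] -> f i p = f j q -> i = j.
Proof.
move=> i0 j0 p01 q01 fpq.
have [Hmax Hmin] := continuous_inj_not_extremum (ifs_continuous i0) (ifs_inj i0) p01.
have [ij|ji|//] := ltngtP i j.
- by case: Hmin => u u01; rewrite fpq; exact: ifs_order.
- by case: Hmax => u u01; rewrite fpq; exact: ifs_order.
Qed.

(** As [f 1] lies above [f i], a value 1 of [f i] would make [f 1] constantly 1, against
    injectivity. *)
Lemma ifs_interior i u : (1 < i)%N -> u \in `[0, 1] -> 0 < f i u < 1.
Proof.
move=> i1 u01; have i0 := ltnW i1.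
have /andP[-> fu1] := ifs_range i0 u01; rewrite lt_neqAle fu1 andbT/=.
apply/eqP => fu.
have f1 q : q \in `[0, 1] -> f 1%N q = 1.
  move=> q01; apply/eqP; rewrite eq_le -{2}fu (ifs_order _ i1)// andbT.
  by have /andP[] := ifs_range (ltnSn 0) q01.
have i0' : (0 : R) \in `[0, 1] by rewrite in_itv/= lexx ler01.
have i1' : (1 : R) \in `[0, 1] by rewrite in_itv/= lexx ler01.
have := ifs_inj (ltnSn 0) i0' i1'; rewrite !f1// => /(_ erefl)/eqP.
by rewrite eq_sym oner_eq0.
Qed.

Definition cylinder (w : seq nat) : set R := compw f w @` `[0, 1].

Lemma compw_cat w v u : compw f (w ++ v) u = compw f w (compw f v u).
Proof. by elim: w => //= i w ->. Qed.

Lemma compw_in w u : positive_word w -> u \in `[0, 1] -> compw f w u \in `[0, 1].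
Proof.
by move=> + u01; elim: w => //= i w IH /andP[i0 /IH w0]; exact: ifs_in.
Qed.

Lemma positive_mkseq (a : nat -> nat) n :
  (forall k, (0 < a k)%N) -> positive_word (mkseq a n).
Proof. by move=> a0; apply/allP => i /mapP[k _ ->]. Qed.

(** The bounds multiply along the word. Where only the upper one matters, [c = 0] is taken. *)
Lemma compw_dist (c C : nat -> R) w u v :
  (forall i, (0 < i)%N -> 0 <= c i) -> (forall i, (0 < i)%N -> 0 <= C i) ->
  (forall i, (0 < i)%N -> forall u v, u \in `[0, 1] -> v \in `[0, 1] ->
    c i * `|u - v| <= `|f i u - f i v| <= C i * `|u - v|) ->
  positive_word w -> u \in `[0, 1] -> v \in `[0, 1] ->
  (\prod_(i <- w) c i) * `|u - v| <= `|compw f w u - compw f w v|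
    <= (\prod_(i <- w) C i) * `|u - v|.
Proof.
move=> c0 C0 cC + u01 v01; elim: w => [|i w IH] /=.
  by rewrite !big_nil !mul1r lexx.
move=> /andP[i0 w0]; have /andP[IH1 IH2] := IH w0.
have /andP[h1 h2] := cC i i0 _ _ (compw_in w0 u01) (compw_in w0 v01).
rewrite !big_cons -!mulrA; apply/andP; split.
  by apply: le_trans h1; rewrite ler_wpM2l// c0.
by apply: (le_trans h2); rewrite ler_wpM2l// C0.
Qed.

(** Closedness puts the limit of the points [compw f (mkseq a n) 1] into every cylinder of its own
    digits. *)
Lemma cylinder_closed w : positive_word w -> closed (cylinder w).
Proof.
move=> w0; apply: compact_closed; first exact: Rhausdorff.
apply: continuous_compact; last exact: segment_compact.
have [C1 [C2 [C10 C20 C12]]] := ifs_dist_bounds ltr01.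
apply: (@lipschitz_within_continuous _ _ _ (\prod_(i <- w) (C2 / i%:R `^ (d - 1)))).
move=> u v /= u01 v01.
have pos (C e : R) i : 0 < C -> (0 < i)%N -> 0 <= C / i%:R `^ e.
  by move=> C0 i0; rewrite divr_ge0// ?powR_ge0 ?ltW.
by have /andP[] := compw_dist (fun i => pos _ _ i C10) (fun i => pos _ _ i C20) C12 w0 u01 v01.
Qed.

Lemma compw_mkseq_cylinder (a : nat -> nat) n m : (forall k, (0 < a k)%N) ->
  (n <= m)%N -> cylinder (mkseq a n) (compw f (mkseq a m) 1).
Proof.
move=> a0 nm; rewrite -(subnKC nm) mkseqD compw_cat.
exists (compw f (mkseq (fun i => a (n + i)%N) (m - n)) 1) => //=.
apply: compw_in; first by apply: positive_mkseq => k; exact: a0.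
by rewrite in_itv/= lexx ler01.
Qed.

Lemma coding_map_cylinder (a : nat -> nat) n : (forall k, (0 < a k)%N) ->
  cvgn (fun n => compw f (mkseq a n) 1) -> cylinder (mkseq a n) (coding_map f a).
Proof.
move=> a0 cv; apply: closed_cvg cv; first exact/cylinder_closed/positive_mkseq.
by near=> m; apply: compw_mkseq_cylinder => //; near: m; exact: nbhs_infty_ge.
Unshelve. all: by end_near. Qed.

(* A divergent coding has the junk limit 0. *)
Lemma codes_cylinder x a n : x != 0 -> codes f x a -> cylinder (mkseq a n) x.
Proof.
move=> x0 [a0 ax].
have [cv|ncv] := pselect (cvgn (fun n => compw f (mkseq a n) 1)).
  by rewrite -ax; exact: coding_map_cylinder.
by move: x0; rewrite -ax /coding_map (dvgP ncv) eqxx.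
Qed.

(** From index [N] on, all points lie in the cylinder of the first [N] digits, whose length is at
    most the product of the [C i]; so the sequence is Cauchy. *)
Lemma coding_cvg (a : nat -> nat) (C : nat -> R) : (forall k, (0 < a k)%N) ->
  (forall i, (0 < i)%N -> 0 <= C i) ->
  (forall i, (0 < i)%N -> forall u v, u \in `[0, 1] -> v \in `[0, 1] ->
    `|f i u - f i v| <= C i * `|u - v|) ->
  (fun n => \prod_(i <- mkseq a n) C i) @ \oo --> (0 : R) ->
  cvgn (fun n => compw f (mkseq a n) 1).
Proof.
move=> a0 C0 fC /cvgr0Pnorm_lt aC.
apply/cauchy_cvgP/cauchy_exP => e e0.
have [N _ /(_ N (leqnn N)) NC] := aC e e0.
exists (compw f (mkseq a N) 1).
exists N => // m Nm.
have i1 : (1 : R) \in `[0, 1] by rewrite in_itv/= lexx ler01.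
have [z /= z01 <-] := compw_mkseq_cylinder a0 Nm.
apply: le_lt_trans NC.
have fC' i : (0 < i)%N -> forall u v, u \in `[0, 1] -> v \in `[0, 1] ->
    0 * `|u - v| <= `|f i u - f i v| <= C i * `|u - v|.
  by move=> i0 u v u01 v01; rewrite mul0r normr_ge0/= fC.
have /andP[_ h] := compw_dist (fun _ _ => lexx 0) C0 fC' (positive_mkseq N a0) i1 z01.
apply: (le_trans h); apply: le_trans (ler_norm _).
rewrite ler_piMr//; first by rewrite big_seq; apply: prodr_ge0 => i /mapP[k _ ->]; exact: C0.
by move: z01; rewrite in_itv/= => /andP[? ?]; rewrite ger0_norm; lra.
Qed.

(** Letters are compared from the left by [ifs_eq_digit]. Letters of [w] above 1 keep the inner
    points in the open interval, which rules out a common endpoint of two cylinders. *)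
Lemma compw_unique w v z y : size w = size v -> all (fun i => 1 < i)%N w ->
  positive_word v -> 0 < z < 1 -> y \in `[0, 1] ->
  compw f w z = compw f v y -> w = v.
Proof.
move=> + + + z01 y01; have z01' : z \in `[0, 1].
  by case/andP: z01 => *; rewrite in_itv/= !ltW.
elim: w v => [|i w IH] [|j v]//= [wv] /andP[i1 w1] /andP[j0 v0] fwv.
have w0 : positive_word w by apply: sub_all w1 => k; exact: ltnW.
have wz : 0 < compw f w z < 1.
  by case: w w1 w0 {IH fwv wv} => //= k w /andP[k1 w1] /andP[k0 w0]; exact/ifs_interior/compw_in.
have ij := ifs_eq_digit (ltnW i1) j0 wz (compw_in v0 y01) fwv.
rewrite -ij in fwv *; congr (_ :: _); apply: IH => //.
by apply: (ifs_inj (ltnW i1)) => //; exact: compw_in.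
Qed.

Lemma codes_unique x a b : (forall k, (1 < a k)%N) -> x != 0 ->
  codes f x a -> codes f x b -> a = b.
Proof.
move=> a1 x0 xa xb; apply/funext => n.
(* One digit more on the side of [a]: the inner point [f (a n.+1) z] is then interior, as
   [compw_unique] demands. *)
have [z z01 az] := codes_cylinder n.+2 x0 xa.
have [y y01 bxy] := codes_cylinder n.+1 x0 xb.
have mk : mkseq a n.+2 = mkseq a n.+1 ++ [:: a n.+1].
  by rewrite -[n.+2]addn1 mkseqD [X in _ ++ X]/mkseq /= addn0.
move: az; rewrite mk compw_cat => az.
have : mkseq a n.+1 = mkseq b n.+1.
  apply: (@compw_unique _ _ (f (a n.+1) z) y) => //.
  - by rewrite !size_mkseq.
  - by apply/allP => i /mapP[k _ ->].
  - by apply: positive_mkseq; case: xb.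
  - exact: ifs_interior.
  - by rewrite bxy; exact: az.
by move=> /(congr1 (fun s => nth 0%N s n)); rewrite !nth_mkseq.
Qed.

(* The cylinder of the digit [l] separates those of [i] and [j]. *)
Lemma ifs_gap i j l u v (c : R) : (0 < j)%N -> (j < l)%N -> (l < i)%N ->
  u \in `[0, 1] -> v \in `[0, 1] ->
  (forall u v, u \in `[0, 1] -> v \in `[0, 1] -> c * `|u - v| <= `|f l u - f l v|) ->
  c <= `|f i u - f j v|.
Proof.
move=> j0 jl li u01 v01 /(_ 1 0).
have i0 : (0 : R) \in `[0, 1] by rewrite in_itv/= lexx ler01.
have i1 : (1 : R) \in `[0, 1] by rewrite in_itv/= lexx ler01.
move=> /(_ i1 i0); rewrite subr0 normr1 mulr1 => /le_trans; apply.
have l0 : (0 < l)%N := leq_ltn_trans (leq0n j) jl.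
have A0 := ifs_order l0 li u01 i0; have A1 := ifs_order l0 li u01 i1.
have B0 := ifs_order j0 jl i0 v01; have B1 := ifs_order j0 jl i1 v01.
rewrite (distrC (f i u)) [leRHS]ger0_norm ?ler_norml; last lra.
by apply/andP; split; lra.
Qed.

End IFS.

(** * Covers, null sets and Hausdorff dimension *)

Section Hausdorff.
Context {R : realType}.
Implicit Types (A B U : set R) (s : R).
Local Open Scope ereal_scope.

Lemma diam_pow_ge0 s U : 0 <= diam_pow s U.
Proof. by rewrite /diam_pow; case: ifP => // _; exact: poweR_ge0. Qed.

Lemma diam_pow_le s U (D : R) : (0 <= s)%R -> (0 <= D)%R ->
  (forall x y, U x -> U y -> (`|x - y| <= D)%R) -> diam_pow s U <= (D `^ s)%:E.
Proof.
move=> s0 D0 UD; rewrite /diam_pow; case: ifPn => [_|/set0P[x Ux]].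
  by rewrite lee_fin powR_ge0.
rewrite -poweR_EFin; apply: gt0_ler_poweR => //.
- rewrite in_itv/= leey andbT; apply: ereal_sup_ubound.
  by exists x => //; exists x => //; rewrite subrr normr0.
- by rewrite in_itv/= lee_fin D0 leey.
- by apply: ge_ereal_sup => _ [y Uy [z Uz <-]]; rewrite lee_fin UD.
Qed.

Lemma le_diam_pow s U x y : (0 <= s)%R -> U x -> U y ->
  (`|x - y| `^ s)%:E <= diam_pow s U.
Proof.
move=> s0 Ux Uy; rewrite /diam_pow ifF; last by apply/eqP => U0; rewrite U0 in Ux.
have xyU : `|x - y|%:E <= diam U by apply: ereal_sup_ubound; exists x => //; exists y.
rewrite -poweR_EFin; apply: gt0_ler_poweR => //.
- by rewrite in_itv/= lee_fin normr_ge0 leey.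
- by rewrite in_itv/= leey andbT (le_trans _ xyU)// lee_fin.
Qed.

Lemma diam_le_of_diam_pow s U (delta : R) : (0 < s)%R -> (0 < delta)%R ->
  diam_pow s U <= (delta `^ s)%:E -> diam U <= delta%:E.
Proof.
move=> s0 d0 H; apply: ge_ereal_sup => _ [x Ux [y Uy <-]]; rewrite lee_fin.
have := le_trans (le_diam_pow (ltW s0) Ux Uy) H; rewrite lee_fin.
by apply: contraTT; rewrite -!ltNge => h; rewrite gt0_ltr_powR// nnegrE ltW.
Qed.

(** The diameters are not restricted: for [s > 0] a small sum already forces them to be small. *)
Definition hausdorff_null s A := forall e : R, (0 < e)%R ->
  exists U : nat -> set R, A `<=` \bigcup_k U k /\ \sum_(k <oo) diam_pow s (U k) <= e%:E.

Lemma hausdorff_measure_ge0 s A : 0 <= hausdorff_measure s A.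
Proof.
apply: (@le_trans _ _ (hausdorff_premeasure s 1 A)).
  apply: le_ereal_inf_tmp => _ [U _ <-].
  by apply: nneseries_ge0 => *; exact: diam_pow_ge0.
by apply: ereal_sup_ubound; exists 1%R => /=.
Qed.

Lemma hausdorff_null_measure s A : (0 < s)%R -> hausdorff_null s A ->
  hausdorff_measure s A = 0.
Proof.
move=> s0 nA; apply/eqP; rewrite eq_le hausdorff_measure_ge0 andbT.
apply: ge_ereal_sup => _ [delta /= d0 <-].
apply/lee_addgt0Pr => e e0; rewrite add0e.
(* A sum below the [s]-th power of [delta] bounds each of its terms by that power, hence each
   diameter by [delta]. *)
have m0 : (0 < Num.min e (delta `^ s))%R by rewrite lt_min e0 powR_gt0.
have [U [AU Ue]] := nA _ m0.
have Ue' : \sum_(k <oo) diam_pow s (U k) <= e%:E.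
  by apply: (le_trans Ue); rewrite lee_fin ge_min lexx.
apply: le_trans Ue'; apply: ereal_inf_lbound; exists U => //; split => // k.
apply: diam_le_of_diam_pow s0 d0 _.
apply: (@le_trans _ _ (\sum_(0 <= k < k.+1) diam_pow s (U k))).
  rewrite big_nat_recr//= leeDr// sume_ge0// => *; exact: diam_pow_ge0.
apply: (le_trans (nneseries_lim_ge _ _)) => [*|]; first exact: diam_pow_ge0.
by apply: (le_trans Ue); rewrite lee_fin ge_min lexx orbT.
Qed.

Lemma hausdorff_null_sub s A B : A `<=` B -> hausdorff_null s B -> hausdorff_null s A.
Proof.
move=> AB nB e /nB[U [BU Ue]]; exists U; split=> //; exact: subset_trans BU.
Qed.

Lemma hausdorff_null_set1 s (x : R) : (0 < s)%R -> hausdorff_null s [set x].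
Proof.
move=> s0 e e0; exists (fun=> [set x]); split; first by move=> y yx; exists 0%N.
rewrite (eq_eseriesr (g := fun=> 0)); first by rewrite eseries0// lee_fin ltW.
move=> i _; apply/eqP; rewrite eq_le diam_pow_ge0 andbT.
apply: (le_trans (diam_pow_le (D := 0) _ _ _)) => //; first exact: ltW.
- by move=> y z -> ->; rewrite subrr normr0.
- by rewrite lee_fin powR0 ?gt_eqF.
Qed.

(** Finite sums over distinct indices suffice. Numbers that code no element of [T] receive the empty
    set, whose [diam_pow] is 0. *)
Lemma countable_cover (T : countType) (V : T -> set R) s A (e : \bar R) :
  A `<=` \bigcup_t V t ->
  (forall l : seq T, uniq l -> \sum_(t <- l) diam_pow s (V t) <= e) ->
  exists U : nat -> set R, A `<=` \bigcup_k U k /\ \sum_(k <oo) diam_pow s (U k) <= e.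
Proof.
move=> AV Ve; exists (fun k => oapp V set0 (pickle_inv k)); split.
  by move=> x /AV[t _ Vt]; exists (pickle t) => //=; rewrite pickleK_inv.
apply: lime_le; first by apply: is_cvg_nneseries => *; exact: diam_pow_ge0.
near=> n; apply: le_trans (Ve (pmap pickle_inv (iota 0 n)) _); last first.
  by rewrite (pmap_uniq (@pickle_invK T))// iota_uniq.
rewrite big_pmap /index_iota subn0.
apply: lee_sum => k _; case: (pickle_inv k) => //=.
by rewrite /diam_pow eqxx.
Unshelve. all: by end_near. Qed.

Lemma hausdorff_null_bigcup s (F : nat -> set R) :
  (forall n, hausdorff_null s (F n)) -> hausdorff_null s (\bigcup_n F n).
Proof.
move=> nF e e0.
have en n : (0 < e / (2 ^ n.+1)%:R)%R by rewrite divr_gt0// ltr0n expn_gt0.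
have /choice[U UP] n := nF n _ (en n).
apply: (@countable_cover _ (fun p : nat * nat => U p.1 p.2)).
  by move=> x [n _ /(proj1 (UP n))[k _ Ux]]; exists (n, k).
move=> l ul.
apply: (@le_trans _ _ (\esum_(p in [set: nat * nat]) diam_pow s (U p.1 p.2))).
  apply: esum_ge; exists [set` l]; first by split => //; exact: finite_seq.
  by rewrite -fsbig_seq.
rewrite -[setT]setXTT.
rewrite -(@esum_esum _ _ _ _ (fun=> setT) (fun n k => diam_pow s (U n k))); last first.
  by move=> *; exact: diam_pow_ge0.
apply: le_trans (epsilon_trick0 xpredT (ltW e0)).
rewrite -nneseries_esumT; last by move=> n; apply: esum_ge0 => *; exact: diam_pow_ge0.
apply: lee_nneseries => [n _ _|n _]; first by apply: esum_ge0 => *; exact: diam_pow_ge0.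
rewrite -nneseries_esumT; last by move=> *; exact: diam_pow_ge0.
exact: (proj2 (UP n)).
Qed.

Lemma hausdorff_null_bigcup_countType s (T : countType) (F : T -> set R) :
  (forall t, hausdorff_null s (F t)) -> hausdorff_null s (\bigcup_t F t).
Proof.
move=> nF; pose G k := oapp F set0 (@pickle_inv T k).
apply: (@hausdorff_null_sub _ _ (\bigcup_k G k)).
  by move=> x [t _ Ft]; exists (pickle t) => //; rewrite /G pickleK_inv.
apply: hausdorff_null_bigcup => k; rewrite /G; case: (pickle_inv k) => //= e e0.
exists (fun=> set0); split => //.
rewrite (eq_eseriesr (g := fun=> 0)); first by rewrite eseries0// lee_fin ltW.
by move=> i _; rewrite /diam_pow eqxx.
Qed.

(* The inverse of [x] is an [s]-Hoelder map onto [[0, 1[], so a cover of [A] with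
   small [s]-sum would give a cover of [[0, 1[] of Lebesgue measure below 1. *)
Lemma hausdorff_measure_neq0 s (C : R) (x : R -> R) A : (0 <= s)%R -> (0 < C)%R ->
  (forall y, y \in `[0%R, 1%R[ -> A (x y)) ->
  (forall y z, y \in `[0%R, 1%R[ -> z \in `[0%R, 1%R[ ->
    (`|y - z| <= C * `|x y - x z| `^ s)%R) ->
  hausdorff_measure s A <> 0.
Proof.
move=> s0 C0 Ax xC H0.
have C2 : (0 < 2 * C)%R by rewrite mulr_gt0.
have : hausdorff_premeasure s 1 A < ((2 * C)^-1)%:E.
  apply: (@le_lt_trans _ _ 0); last by rewrite lte_fin invr_gt0.
  by rewrite -H0; apply: ereal_sup_ubound; exists 1%R => /=.
move=> /ereal_inf_lt[_ [U [AU _] <-] Ulim].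
have Ufin k : diam_pow s (U k) \is a fin_num.
  rewrite ge0_fin_numE ?diam_pow_ge0//.
  apply: le_lt_trans (lt_trans Ulim (ltry _)).
  apply: (@le_trans _ _ (\sum_(0 <= k < k.+1) diam_pow s (U k))).
    rewrite big_nat_recr//= leeDr// sume_ge0// => *; exact: diam_pow_ge0.
  by apply: nneseries_lim_ge => *; exact: diam_pow_ge0.
pose r k := fine (diam_pow s (U k)).
have r0 k : (0 <= r k)%R by rewrite fine_ge0// diam_pow_ge0.
(* If [U k] contains a point [x y], the parameters of all such points lie within [C * r k] of [y],
   in an interval of length [2 * C * r k]. *)
have /choice[Y YP] : forall k, exists J : set R, [/\ measurable J,
    lebesgue_measure J <= (2 * C)%:E * diam_pow s (U k) &
    forall y, y \in `[0%R, 1%R[ -> U k (x y) -> J y].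
  move=> k; have [[y y01 Uy]|no] := pselect (exists2 y, y \in `[0%R, 1%R[ & U k (x y)).
  - exists `[(y - C * r k)%R, (y + C * r k)%R]%classic; split => //.
      rewrite lebesgue_measure_itv/= lte_fin; case: ifP => _.
        rewrite -EFinB -(fineK (Ufin k)) -EFinM lee_fin -/(r k); lra.
      by rewrite mule_ge0 ?diam_pow_ge0// lee_fin ltW.
    move=> z z01 Uz; rewrite /= in_itv/=.
    have : (`|z - y| <= C * r k)%R.
      apply: (le_trans (xC _ _ z01 y01)); apply: ler_wpM2l; first exact: ltW.
      by have := le_diam_pow s0 Uz Uy; rewrite -(fineK (Ufin k)) lee_fin.
    by rewrite ler_norml => /andP[? ?]; apply/andP; split; lra.
  - exists set0; split => //.
      by rewrite measure0 mule_ge0 ?diam_pow_ge0// lee_fin ltW.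
    by move=> y y01 Uy; case: no; exists y.
have : lebesgue_measure (`[0%R, 1%R[%classic : set R) <= \sum_(k <oo) lebesgue_measure (Y k).
  apply: measure_sigma_subadditive => //; first by move=> k; case: (YP k).
  move=> y y01; have /AU[k _ Uk] := Ax _ y01.
  by exists k => //; case: (YP k) => _ _; exact.
rewrite lebesgue_measure_itv/= lte_fin ltr01 sube0 => /le_trans.
move=> /(_ (\sum_(k <oo) (2 * C)%:E * diam_pow s (U k))) H.
have : 1 <= \sum_(k <oo) (2 * C)%:E * diam_pow s (U k).
  by apply: H; apply: lee_nneseries => k _ //; case: (YP k).
rewrite nneseriesZl; last by move=> *; exact: diam_pow_ge0.
rewrite leNgt => /negP; apply.
by rewrite -lte_pdivlMl// mule1.
Qed.

Lemma le_hausdorff_measure s A B : A `<=` B -> hausdorff_measure s A <= hausdorff_measure s B.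
Proof.
move=> AB; apply: ge_ereal_sup => _ [e e0 <-].
apply: (@le_trans _ _ (hausdorff_premeasure s e B)); last first.
  by apply: ereal_sup_ubound; exists e.
apply: ereal_inf_le_tmp => _ [U [BU Ue] <-]; exists U => //; split => //.
exact: subset_trans BU.
Qed.

Lemma le_hausdorff_dim A B : A `<=` B -> hausdorff_dim A <= hausdorff_dim B.
Proof.
move=> AB; apply: ereal_inf_le_tmp => _ [s [s0 Bs] <-]; exists s => //; split => //.
by apply/eqP; rewrite eq_le hausdorff_measure_ge0 andbT -Bs le_hausdorff_measure.
Qed.

(** The loss from [s] to [u] vanishes in the infimum; it leaves room for the [eps] of the regularity
    condition. *)
Lemma hausdorff_dim_le A B :
  (forall s u, (0 <= s)%R -> (s < u)%R -> hausdorff_measure s A = 0 ->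
    hausdorff_measure u B = 0) ->
  hausdorff_dim B <= hausdorff_dim A.
Proof.
move=> H; apply: le_ereal_inf_tmp => _ [s [s0 As] <-].
apply/lee_addgt0Pr => e e0; rewrite -EFinD.
apply: ereal_inf_lbound; exists (s + e)%R => //=; split; first by rewrite addr_ge0// ltW.
by apply: H As => //; rewrite ltrDl.
Qed.

End Hausdorff.

(** * Total weight of nondecreasing words *)

Section WordSums.
Context {R : realType}.
Variables (q : nat -> R).
Hypothesis q0 : forall j, 0 <= q j.

Let word_weight (w : seq nat) : R := \prod_(i <- w) q i.

Let word_weight_ge0 w : 0 <= word_weight w.
Proof. by apply: prodr_ge0 => i _. Qed.

(* A generating function bound: [2 ^ n] times the complete homogeneous symmetric
   polynomial of degree [n] in the [q j] is at most [\prod_j (1 - 2 q j)^-1]. *)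
Lemma sorted_words_sum_le k n L (l : seq (seq nat)) :
  (forall j, (L <= j)%N -> q j <= 4^-1) -> uniq l ->
  (forall w, w \in l ->
    [/\ size w = n, sorted leq w & all (fun i => (L <= i < L + k)%N) w]) ->
  2 ^+ n * \sum_(w <- l) word_weight w <= expR (4 * \sum_(L <= j < L + k) q j).
Proof.
have nil_case (m : nat) K (l' : seq (seq nat)) : uniq l' ->
    (forall w, w \in l' -> size w = 0%N) ->
    \sum_(w <- l') word_weight w <= expR (4 * \sum_(m <= j < K) q j).
  move=> ul nl; apply: (@le_trans _ _ 1); last first.
    by rewrite -expR0 ler_expR mulr_ge0// sumr_ge0.
  case: l' ul nl => [|w [|v l']] ul nl; first by rewrite big_nil.
    by rewrite big_seq1 (size0nil (nl w _)) ?mem_head// /word_weight big_nil.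
  have ew := size0nil (nl w (mem_head _ _)).
  have ev : v = [::] by apply/size0nil/nl; rewrite !inE eqxx orbT.
  by move: ul; rewrite ew ev.
elim: k n L l => [|k IHk] n L l qL ul lP.
  case: n lP => [|n] lP.
    by rewrite mul1r; apply: nil_case => // w /lP[].
  case: l ul lP => [|w l] ul lP; first by rewrite big_nil mulr0 expR_ge0.
  have [] := lP w (mem_head _ _); case: w {ul lP} => //= i w _ _ /andP[]; lia.
elim: n l ul lP => [|n IHn] l ul lP.
  by rewrite mul1r; apply: nil_case => // w /lP[].
(* If the first letter is [L], removing it leaves words of length [n] over the same alphabet.
   Otherwise all letters are at least [L.+1], and the alphabet shrinks. *)
rewrite (bigID (fun w => head 0%N w == L))/= mulrDr.
pose l1 := [seq behead w | w <- l & head 0%N w == L].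
have wE w : w \in l -> head 0%N w == L -> w = L :: behead w.
  by move=> /lP[]; case: w => //= i w _ _ _ /eqP ->.
have -> : \sum_(w <- l | head 0%N w == L) word_weight w =
    q L * \sum_(w <- l1) word_weight w.
  rewrite big_map big_filter big_distrr/= big_seq_cond [RHS]big_seq_cond.
  apply: eq_bigr => w /andP[wl wL].
  by rewrite {1}(wE w wl wL) /word_weight big_cons.
rewrite -[X in _ + _ * X]big_filter.
have h1 : 2 ^+ n * \sum_(w <- l1) word_weight w <=
    expR (4 * \sum_(L <= j < L + k.+1) q j).
  apply: IHn.
    rewrite map_inj_in_uniq ?filter_uniq// => w v; rewrite !mem_filter.
    by move=> /andP[wL wl] /andP[vL vl] wv; rewrite (wE w)// (wE v)// wv.
  move=> _ /mapP[w + ->]; rewrite mem_filter => /andP[wL wl].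
  have := lP _ wl; rewrite {1 2 3}(wE w wl wL)/= => -[[sw] pw /andP[_ aw]].
  by split => //; exact: path_sorted pw.
have h2 : 2 ^+ n.+1 * \sum_(w <- [seq w <- l | head 0%N w != L]) word_weight w <=
    expR (4 * \sum_(L.+1 <= j < L.+1 + k) q j).
  apply: IHk; first by move=> j /ltnW; exact: qL.
    exact: filter_uniq.
  move=> w; rewrite mem_filter => /andP[wL /lP[sw ow aw]]; split => //.
  case: w wL sw ow aw => //= i w iL _ pw /andP[iLk aw].
  have Li : (L < i)%N by rewrite ltn_neqAle eq_sym iL; case/andP: iLk.
  apply/andP; split; first by lia.
  apply/allP => j jw; have := allP aw j jw.
  have := allP (order_path_min leq_trans pw) j jw; lia.
have eS : \sum_(L <= j < L + k.+1) q j = q L + \sum_(L.+1 <= j < L.+1 + k) q j.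
  by rewrite addSnnS big_ltn// addnS ltnS leq_addr.
move: h1 h2; rewrite eS mulrDr expRD.
set E := expR (4 * \sum_(_ <= j < _) q j); set F := expR (4 * q L).
set s1 := \sum_(w <- l1) _; set s2 := \sum_(w <- _) _ => h1 h2.
have E0 : 0 < E by exact: expR_gt0.
have Fge : 1 + 4 * q L <= F by exact: expR_ge1Dx.
have qL4 := qL L (leqnn _); have qL0 := q0 L.
rewrite [2 ^+ n.+1 * (_ * _)](_ : _ = 2 * q L * (2 ^+ n * s1)); last by rewrite exprS; ring.
apply: (le_trans (lerD (ler_wpM2l _ h1) h2)); first by rewrite mulr_ge0.
(* For [0 <= x <= 1/4] the product of [1 - 2 x] and [1 + 4 x] is at least 1; hence the factor 4 in
   the exponent and the bound [4^-1] on [q]. *)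
have : 0 <= ((1 - 2 * q L) * F - 1).
  have : (1 - 2 * q L) * (1 + 4 * q L) <= (1 - 2 * q L) * F by rewrite ler_wpM2l//; lra.
  by nra.
by move=> /(mulr_ge0 (ltW E0)); lra.
Qed.

Lemma seq_argmax (T : eqType) (g : T -> nat) (l : seq T) : l != [::] ->
  exists2 w, w \in l & forall v, v \in l -> (g v <= g w)%N.
Proof.
elim: l => // x l IH _; have [->|/IH[w wl wP]] := eqVneq l [::].
  by exists x; rewrite ?mem_head// => v; rewrite inE => /eqP ->.
have [xw|wx] := leqP (g x) (g w).
  by exists w; rewrite ?inE ?wl ?orbT// => v; rewrite inE => /orP[/eqP->|/wP].
exists x; rewrite ?mem_head// => v; rewrite inE => /orP[/eqP->//|/wP].
by move=> /leq_trans; apply; exact: ltnW.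
Qed.

(** For each length [n], the factor [2 ^- n] from [sorted_words_sum_le] against the allowed growth
    [(3 / 2) ^ n] leaves [(3 / 4) ^ n]; the geometric series from [N] on gives the factor 4. *)
Lemma sorted_words_sum_tail L N (c : R) (l : seq (seq nat)) : 0 <= c ->
  (forall j, (L <= j)%N -> q j <= 4^-1) -> uniq l ->
  (forall w, w \in l -> [/\ (N <= size w)%N, sorted leq w, all (leq L) w &
    expR (4 * \sum_(L <= j < (last 0 w).+1) q j) <= c * (3 / 2) ^+ size w]) ->
  \sum_(w <- l) word_weight w <= 4 * c * (3 / 4) ^+ N.
Proof.
move=> c0 qL.
have level n (l' : seq (seq nat)) : uniq l' ->
    (forall w, w \in l' -> [/\ size w = n, sorted leq w, all (leq L) w &
      expR (4 * \sum_(L <= j < (last 0 w).+1) q j) <= c * (3 / 2) ^+ size w]) ->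
    \sum_(w <- l') word_weight w <= c * (3 / 4) ^+ n.
  move=> ul lP; have [->|l0] := eqVneq l' [::].
    by rewrite big_nil mulr_ge0// exprn_ge0// divr_ge0.
  (* The last letter of a sorted word is its largest, so the greatest last letter bounds the
     alphabet of all the words. *)
  have [w wl wmax] := seq_argmax (last 0%N) l0.
  set M := (last 0%N w).+1.
  have : 2 ^+ n * \sum_(w <- l') word_weight w <=
      expR (4 * \sum_(L <= j < L + (M - L)) q j).
    apply: sorted_words_sum_le => // v vl; have [sv ov av _] := lP v vl; split=> //.
    apply/allP => i iv; have := allP av i iv => /= Li.
    have : (i <= last 0%N v)%N.
      case: v vl sv ov iv {av} => //= j v _ _ pv; rewrite inE => iv.
      have : sorted leq (j :: v) by [].
      rewrite (lastI j v) -cats1 (sorted_pairwise leq_trans) pairwise_cat.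
      move=> /and3P[/allrelP H _ _].
      have : i \in j :: v by rewrite inE.
      rewrite lastI mem_rcons inE => /orP[/eqP -> //|ib].
      by apply: H => //; rewrite inE.
    by have := wmax v vl; rewrite /M; lia.
  have -> : \sum_(L <= j < L + (M - L)) q j = \sum_(L <= j < M) q j.
    have [LM|ML] := leqP L M; first by rewrite subnKC.
    by rewrite (eqP (ltnW ML : (_ - _ == 0)%N)) addn0 !big_geq// ltnW.
  have [sw _ _ Sw] := lP w wl; rewrite sw in Sw.
  move=> /le_trans /(_ Sw); rewrite -ler_pdivlMl ?exprn_gt0// => /le_trans; apply.
  rewrite mulrCA ler_wpM2l// -exprVn -exprMn.
  by rewrite (_ : 2^-1 * (3 / 2) = 3 / 4 :> R)//; field.
suff H k : forall N (l : seq (seq nat)), uniq l ->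
    (forall w, w \in l -> [/\ (N <= size w < N + k)%N, sorted leq w, all (leq L) w &
      expR (4 * \sum_(L <= j < (last 0 w).+1) q j) <= c * (3 / 2) ^+ size w]) ->
    \sum_(w <- l) word_weight w <= 4 * c * (3 / 4) ^+ N.
  move=> ul lP; apply: (H (\max_(w <- l) size w).+1 N) => // w wl.
  have [Nw ? ? ?] := lP w wl; split=> //; rewrite Nw/= addnS ltnS.
  by apply: leq_trans (leq_addl _ _); exact: leq_bigmax_seq.
elim: k => [|k IHk] {}N {}l ul lP.
  case: l ul lP => [|w l] ul lP.
    by rewrite big_nil !mulr_ge0// exprn_ge0// divr_ge0.
  have [+ _ _ _] := lP w (mem_head _ _); lia.
rewrite (bigID (fun w => size w == N))/=.
rewrite -big_filter -[X in _ + X]big_filter.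
apply: (@le_trans _ _ (c * (3 / 4) ^+ N + 4 * c * (3 / 4) ^+ N.+1)).
  apply: lerD.
    apply: level; first exact: filter_uniq.
    by move=> w; rewrite mem_filter => /andP[/eqP sw /lP[? ? ? ?]]; split.
  apply: IHk; first exact: filter_uniq.
  move=> w; rewrite mem_filter => /andP[sw /lP[Nw ? ? ?]]; split=> //.
  by case/andP: Nw => Nw1 Nw2; rewrite addSnnS Nw2 andbT ltn_neqAle eq_sym sw.
by rewrite exprS; set y := (3 / 4) ^+ N; lra.
Qed.

End WordSums.

(** * Covers of points with sparse nondecreasing digits *)

Lemma nondecreasing_bounded_stationary (a : nat -> nat) L :
  (forall k, (a k <= a k.+1)%N) -> (forall k, (a k <= L)%N) ->
  exists K, forall k, (K <= k)%N -> a k = a K.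
Proof.
move=> am aL.
have am' := homo_leq leqnn leq_trans am.
pose P v := `[<exists k, a k = v>].
have Pex : exists v, P v by exists (a 0%N); apply/asboolP; exists 0%N.
have PL v : P v -> (v <= L)%N by move=> /asboolP[k <-].
case: (ex_maxnP Pex PL) => v /asboolP[K <-] vmax; exists K => k Kk.
by apply/eqP; rewrite eqn_leq (am' _ _ Kk) andbT; apply: vmax; apply/asboolP; exists k.
Qed.

Lemma powR_prod (R : realType) (c : nat -> R) s (w : seq nat) : (forall i, 0 <= c i) ->
  (\prod_(i <- w) c i) `^ s = \prod_(i <- w) (c i `^ s).
Proof.
move=> c0; elim: w => [|i w IH]; first by rewrite !big_nil powR1.
by rewrite !big_cons powRM// ?IH//; apply: prodr_ge0.
Qed.

Section UpperBound.
Context {R : realType}.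
Variables (d : R) (f : nat -> R -> R).
Hypothesis hf : gauss_like_ifs d f.
Variables (C : nat -> R) (s : R).
Hypothesis C0 : forall i, 0 <= C i.
Hypothesis s0 : 0 < s.
Hypothesis fC : forall i, (0 < i)%N -> forall u v, u \in `[0, 1] -> v \in `[0, 1] ->
  `|f i u - f i v| <= C i * `|u - v|.

Lemma diam_pow_cylinder w : positive_word w ->
  (diam_pow s (cylinder f w) <= (\prod_(i <- w) (C i `^ s))%:E)%E.
Proof.
move=> w0; rewrite -powR_prod//; apply: diam_pow_le; [exact: ltW|exact: prodr_ge0|].
move=> _ _ [u /= u01 <-] [v /= v01 <-].
have fC' i : (0 < i)%N -> forall u v, u \in `[0, 1] -> v \in `[0, 1] ->
    0 * `|u - v| <= `|f i u - f i v| <= C i * `|u - v|.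
  by move=> i0 x y x01 y01; rewrite mul0r normr_ge0/= fC.
have /andP[_ h] := compw_dist hf (fun _ _ => lexx 0) (fun i _ => C0 i) fC' w0 u01 v01.
apply: (le_trans h); rewrite ler_piMr ?prodr_ge0//.
by move: u01 v01; rewrite !in_itv/= ler_norml => /andP[? ?] /andP[? ?]; apply/andP; split; lra.
Qed.

Variables (L : nat) (c : R).
Hypothesis L0 : (0 < L)%N.
Hypothesis c0 : 0 < c.
Hypothesis CL : forall j, (L <= j)%N -> C j `^ s <= 4^-1.

(* Indices start from 0 : the condition at [n] bears on the first [n.+1] digits. *)
Definition often_sparse (a : nat -> nat) : Prop := forall N, exists2 n, (N <= n)%N &
  expR (4 * \sum_(L <= j < (a n).+1) C j `^ s) <= c * (3 / 2) ^+ n.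

(** With the prefix [w] fixed, every later digit is at least [L] and contributes a factor at most
    [4^-1]. Each sparse index gives a cylinder [w ++ v] around [x]; since such indices occur
    arbitrarily late, [v] can be taken as long as desired. *)
Lemma hausdorff_null_prefix w : hausdorff_null s [set x | exists a : nat -> nat,
  [/\ x != 0, codes f x a, forall k, (a k <= a k.+1)%N, often_sparse a &
   mkseq a (size w) = w /\ forall k, (size w <= k)%N -> (L <= a k)%N]].
Proof.
have [w0|nw0] := boolP (positive_word w); last first.
  (* Codings have positive digits, so the set is empty here. *)
  apply: (@hausdorff_null_sub _ _ _ [set 0]); last exact: hausdorff_null_set1.
  by move=> x [a [_ [a0 _] _ _ [aw _]]]; move: nw0; rewrite -aw positive_mkseq.
move=> e e0.
(* [c'] absorbs the difference between the index [n] and the length of [v]. *)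
set Kw := \prod_(i <- w) (C i `^ s); set c' := c * (3 / 2) ^+ size w.
have Kw0 : 0 <= Kw by apply: prodr_ge0 => i _; exact: powR_ge0.
have c'0 : 0 <= c' by rewrite mulr_ge0 ?(ltW c0)// exprn_ge0// divr_ge0.
have [N NP] : exists N, Kw * (4 * c' * (3 / 4) ^+ N) <= e.
  have h : (fun n => Kw * (4 * c') * (3 / 4) ^+ n) @ \oo --> (0 : R).
    rewrite -(mulr0 (Kw * (4 * c'))); apply: cvgMl_tmp; apply: cvg_expr.
    by rewrite ger0_norm ?divr_ge0//; lra.
  have /cvgrPdist_le/(_ e e0)[N _ /(_ N (leqnn N))] := h.
  rewrite sub0r normrN => hN; exists N; rewrite mulrA; exact: le_trans (ler_norm _) hN.
pose P (v : seq nat) := [&& (N <= size v)%N, sorted leq v, all (leq L) v &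
  expR (4 * \sum_(L <= j < (last 0%N v).+1) C j `^ s) <= c' * (3 / 2) ^+ size v].
pose V v := if P v then cylinder f (w ++ v) else set0.
apply: (countable_cover (V := V)).
- move=> x [a [x0 xa am aI [aw aL]]].
  have [n Nn aS] := aI (N + size w)%N.
  pose k := (n - size w)%N.
  have nk : n = (size w + k)%N by rewrite /k; lia.
  pose v := mkseq (fun i => a (size w + i)%N) k.+1.
  exists v => //; rewrite /V ifT.
    have -> : w ++ v = mkseq a (size w + k.+1) by rewrite mkseqD aw.
    exact: (codes_cylinder hf _ x0 xa).
  have sv : size v = k.+1 by rewrite size_mkseq.
  apply/and4P; split.
  + by rewrite sv /k; lia.
  + rewrite /v /mkseq sorted_map; apply: sub_sorted (iota_ltn_sorted 0 _) => i j /ltnW ij /=.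
    by apply: (homo_leq leqnn leq_trans am); rewrite leq_add2l.
  + by apply/allP => _ /mapP[i _ ->]; apply: aL; exact: leq_addr.
  + rewrite (_ : last 0%N v = a n); last first.
      by rewrite (last_nth 0%N) sv /= nk /v; rewrite -[X in nth _ X _]/(v) nth_mkseq.
    apply: (le_trans aS); rewrite /c' -mulrA ler_wpM2l ?(ltW c0)// -exprD sv.
    by rewrite nk; apply: ler_weXn2l; [lra | lia].
- move=> l ul; rewrite (bigID P)/= [X in (_ + X)%E]big1; last first.
    by move=> v /negPf Pv; rewrite /V Pv /diam_pow eqxx.
  rewrite adde0 -big_filter.
  apply: (@le_trans _ _ (\sum_(v <- [seq v <- l | P v]) (Kw * \prod_(i <- v) (C i `^ s))%:E)%E).
    rewrite big_seq [leRHS]big_seq; apply: lee_sum => v; rewrite mem_filter => /andP[Pv _].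
    rewrite /V Pv /Kw -big_cat; apply: diam_pow_cylinder.
    rewrite /positive_word all_cat; apply/andP; split => //.
    by have /and4P[_ _ + _] := Pv; apply: sub_all => i; exact: leq_trans.
  rewrite sumEFin lee_fin -mulr_sumr; apply: le_trans NP; rewrite ler_wpM2l//.
  apply: sorted_words_sum_tail => //; [by move=> j; exact: powR_ge0|exact: CL|exact: filter_uniq|].
  by move=> v; rewrite mem_filter => /andP[/and4P[? ? ? ?] _]; split.
Qed.

(** Either some digit reaches [L], and the digits before it form one of countably many prefixes, or
    the digits are bounded, hence eventually constant, and [x] is one of countably many points. *)
Lemma hausdorff_null_sparse (A : set R) :
  (forall x, A x -> exists a : nat -> nat,
    [/\ x != 0, codes f x a, forall k, (a k <= a k.+1)%N & often_sparse a]) ->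
  hausdorff_null s A.
Proof.
move=> AP.
(* The default value of [nth] repeats the last letter of [w] forever. *)
pose stationary w := coding_map f (fun k => nth (last 0%N w) w k).
pose F (p : seq nat * bool) : set R := if p.2 then [set stationary p.1] else
  [set x | exists a : nat -> nat,
  [/\ x != 0, codes f x a, forall k, (a k <= a k.+1)%N, often_sparse a &
   mkseq a (size p.1) = p.1 /\ forall k, (size p.1 <= k)%N -> (L <= a k)%N]].
apply: (@hausdorff_null_sub _ _ _ (\bigcup_p F p)); last first.
  apply: hausdorff_null_bigcup_countType => -[w []]; rewrite /F /=.
    exact: hausdorff_null_set1.
  exact: hausdorff_null_prefix.
move=> x /AP[a [x0 xa am aI]].
have [[k Lk]|aL] := pselect (exists k, (L <= a k)%N).
  exists (mkseq a k, false) => //=; rewrite /F /=; exists a; split => //.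
  rewrite size_mkseq; split=> // j kj; apply: (leq_trans Lk).
  exact: (homo_leq leqnn leq_trans am).
have [k|K aK] := nondecreasing_bounded_stationary (L := L) am.
  by rewrite leqNgt; apply/negP => /ltnW Lk; apply: aL; exists k.
exists (mkseq a K.+1, true) => //=; rewrite /F /= /stationary.
case: xa => _ <-; congr (coding_map f _); apply/funext => k.
have [kK|Kk] := ltnP k K.+1; first by rewrite nth_mkseq.
rewrite nth_default ?size_mkseq// (last_nth 0%N) size_mkseq aK; last exact: ltnW.
by rewrite -[nth _ _ _]/(nth 0%N (mkseq a K.+1) K) nth_mkseq.
Qed.

End UpperBound.

(** * Power sums and a growth criterion for null sets *)

Section PowerSums.
Context {R : realType}.
Implicit Types (p x g K : R).

Lemma powR_eventually_ge g K : 0 < g ->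
  exists N, forall n, (N <= n)%N -> K <= n%:R `^ g.
Proof.
move=> g0; exists (Num.truncn (`|K| `^ g^-1)).+1 => n Nn.
apply: (le_trans (ler_norm K)).
have -> : `|K| = (`|K| `^ g^-1) `^ g by rewrite -powRrM mulVf ?gt_eqF// powRr1.
rewrite ge0_ler_powR ?nnegrE ?powR_ge0//; first exact: ltW.
by rewrite (le_trans (ltW (truncnS_gt _)))// ler_nat.
Qed.

Lemma powR_sum_step p x : 0 < x -> p < 1 -> p != 0 ->
  (x + 1) `^ (p - 1) <= ((x + 1) `^ p - x `^ p) / p.
Proof.
move=> x0 p1 p0.
have [|||c] := @MVT R (fun y => y `^ p) (fun y => p * y `^ (p - 1)) x (x + 1).
- by rewrite ltrDl.
- move=> y; rewrite in_itv/= => /andP[xy _].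
  by apply: is_derive1_powR; exact: lt_trans xy.
- apply: derivable_within_continuous => y; rewrite in_itv/= => /andP[xy _].
  have y0 : 0 < y by exact: lt_le_trans xy.
  by case: (is_derive1_powR p y0).
rewrite in_itv/= => /andP[xc cx] ->.
rewrite [x + 1 - x]addrAC subrr add0r mulr1 mulrAC divff// mul1r.
have c0 : 0 < c by exact: lt_trans xc.
rewrite -(opprB 1 p) !powRN lef_pV2 ?posrE ?powR_gt0//; last by rewrite addr_gt0.
by apply: ge0_ler_powR; rewrite ?nnegrE ?subr_ge0 ltW// addr_gt0.
Qed.

(** Comparison with 1 plus the integral of [y ^ (p - 1)] over [[1, n]]. Both signs of [p] are used:
    the bound grows like [n ^ p] for [p > 0] and stays bounded for [p < 0]. *)
Lemma powR_sum_le p n : p < 1 -> p != 0 -> (0 < n)%N ->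
  \sum_(1 <= j < n.+1) j%:R `^ (p - 1) <= 1 + (n%:R `^ p - 1) / p.
Proof.
move=> p1 p0; elim: n => // -[_ _|n IH _].
  by rewrite big_nat1 !powR1 subrr mul0r addr0.
rewrite big_nat_recr//=.
apply: (le_trans (lerD (IH isT) (_ : _ <= ((n.+2%:R) `^ p - n.+1%:R `^ p) / p))).
  by rewrite -[n.+2]addn1 natrD; apply: powR_sum_step; rewrite ?ltr0n.
by rewrite le_eqVlt; apply/orP; left; apply/eqP; field.
Qed.

End PowerSums.

Section UpperCriterion.
Context {R : realType}.
Variables (d : R) (f : nat -> R -> R).
Hypothesis hf : gauss_like_ifs d f.

Lemma hausdorff_null_slow_digits (s p : R) (A : set R) :
  0 < s -> p < 1 -> p != 0 -> 1 - s * d < p ->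
  (forall K, 0 <= K -> exists2 c, 0 < c & forall x, A x -> exists a : nat -> nat,
    [/\ x != 0, codes f x a, forall k, (a k <= a k.+1)%N &
     forall N, exists2 n, (N <= n)%N &
       expR (K * (((a n)%:R `^ p - 1) / p)) <= c * (3 / 2) ^+ n]) ->
  hausdorff_null s A.
Proof.
move=> s0 p1 p0 ps HA.
(* Chosen so that [(d - e) * s = 1 - p]. *)
pose e := (p - (1 - s * d)) / s.
have e0 : 0 < e by rewrite divr_gt0// subr_gt0.
have [C1 [C2 [C10 C20 C12]]] := ifs_dist_bounds hf e0.
pose C (i : nat) := C2 / i%:R `^ (d - e).
have C0 i : 0 <= C i by rewrite divr_ge0 ?powR_ge0// ltW.
have se : (d - e) * s = 1 - p by rewrite /e; field; rewrite gt_eqF.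
have Cs i : C i `^ s = C2 `^ s * i%:R `^ (p - 1).
  by rewrite /C powRM ?invr_ge0 ?powR_ge0 ?(ltW C20)// -powRN -powRrM mulNr se opprB.
have K0 : 0 < C2 `^ s by exact: powR_gt0.
have p1' : 0 < 1 - p by rewrite subr_gt0.
have [L LP] := powR_eventually_ge (4 * C2 `^ s) p1'.
have [|c c0 cA] := HA (4 * C2 `^ s); first by rewrite mulr_ge0// ltW.
have CL j : (L.+1 <= j)%N -> C j `^ s <= 4^-1.
  move=> Lj; have j0 : 0 < j%:R :> R by rewrite ltr0n; case: j Lj.
  rewrite Cs -(opprB 1 p) powRN ler_pdivrMr ?powR_gt0//.
  rewrite -ler_pdivrMl ?invr_gt0// invrK; apply: LP; exact: ltnW.
(* The exponential factor pays for the summand 1 in [powR_sum_le]. *)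
apply: (hausdorff_null_sparse hf C0 s0 _ (ltn0Sn L)
  (mulr_gt0 (expR_gt0 (4 * C2 `^ s)) c0) CL).
  by move=> i i0 u v u01 v01; case/andP: (C12 i i0 u v u01 v01).
move=> x /cA[a [x0 xa am aN]]; exists a; split=> // N.
have [n Nn nP] := aN N; exists n => //.
rewrite -mulrA; apply: le_trans (ler_wpM2l (expR_ge0 _) nP).
set X := _ / p; rewrite -expRD ler_expR.
have -> : 4 * C2 `^ s + 4 * C2 `^ s * X = 4 * (C2 `^ s * (1 + X)) by ring.
rewrite ler_wpM2l//.
have an0 : (0 < a n)%N by case: xa.
apply: le_trans (ler_wpM2l (ltW K0) (powR_sum_le p1 p0 an0)).
rewrite mulr_sumr; under eq_bigr do rewrite Cs.
have [La|aL] := leqP L.+1 (a n).+1; last first.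
  by rewrite big_geq// 1?ltnW// sumr_ge0// => i _; rewrite mulr_ge0 ?powR_ge0.
rewrite [leRHS](big_cat_nat _ La)//= lerDr.
by rewrite sumr_ge0// => i _; rewrite mulr_ge0 ?powR_ge0.
Qed.

End UpperCriterion.

(** * From log-ratios to digits *)

Lemma limn_einf_frequently (R : realType) (u : nat -> \bar R) (l b : \bar R) :
  (limn_einf u <= l)%E -> (l < b)%E -> forall N, exists2 n, (N <= n)%N & (u n < b)%E.
Proof.
move=> ul lb N; apply: contrapT => H.
have ub n : (N <= n)%N -> (b <= u n)%E.
  by move=> Nn; rewrite leNgt; apply/negP => unb; apply: H; exists n.
suff : (b <= limn_einf u)%E by rewrite leNgt (le_lt_trans ul lb).
rewrite limn_einf_lim; apply: lime_ge; first exact: is_cvg_einfs.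
near=> n; apply: le_ereal_inf_tmp => _ [k /= nk <-]; apply: ub.
by apply: leq_trans nk; near: n; exact: nbhs_infty_ge.
Unshelve. all: by end_near. Qed.

Lemma ln_prod (R : realType) (I : Type) (r : seq I) (c : I -> R) :
  (forall i, 0 < c i) -> ln (\prod_(i <- r) c i) = \sum_(i <- r) ln (c i).
Proof.
move=> c0; elim: r => [|i r IH]; first by rewrite !big_nil ln1.
by rewrite !big_cons lnM ?IH// posrE// prodr_gt0.
Qed.

Section Digits.
Context {R : realType}.
Variable f : nat -> R -> R.
Implicit Types (x : R) (a : nat -> nat).

Lemma digit_codes x a : codes f x a -> (forall b, codes f x b -> a = b) ->
  forall n, digit f n x = a n.-1.
Proof. by move=> xa ua n; rewrite /digit -(ua _ (xgetPex _ (ex_intro _ a xa))). Qed.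

Lemma Lambda_codes x : Lambda f x -> exists a, [/\ x != 0, codes f x a,
  forall k, (a k <= a k.+1)%N & forall n, digit f n x = a n.-1].
Proof.
move=> [[/andP[x0 _] [a [xa ua]]] xm]; have da := digit_codes xa ua.
exists a; split=> // [|k]; first by rewrite gt_eqF.
by have := xm k.+1 isT; rewrite !da.
Qed.

Section LogRatio.
Variables (x : R) (a : nat -> nat) (m : nat) (t : 'I_m.+1 -> R).
Hypothesis da : forall n, digit f n x = a n.-1.
Hypothesis a0 : forall k, (0 < a k)%N.
Hypothesis am : forall k, (a k <= a k.+1)%N.
Hypothesis t0 : forall i, 0 <= t i.

Let aln (j k : nat) : (j <= k)%N -> ln (a j)%:R <= ln (a k)%:R :> R.
Proof.
move=> jk; rewrite ler_ln ?posrE ?ltr0n// ler_nat.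
exact: (homo_leq leqnn leq_trans am).
Qed.

Lemma log_ratio_bounds n : (1 < n)%N ->
  (\sum_i t i) * ln (a n.-1)%:R / ln n%:R <= log_ratio f t x n <=
  (\sum_i t i) * ln (a (n + m).-1)%:R / ln n%:R.
Proof.
move=> n1; have ln0 : 0 <= ln n%:R :> R by rewrite ln_ge0// ler1n ltnW.
rewrite /log_ratio ln_prod; last by move=> i; rewrite powR_gt0// ltr0n da.
rewrite !mulr_suml; apply/andP; split; apply: ler_sum => i _;
  rewrite ler_wpM2r ?invr_ge0// ln_powR da ler_wpM2l// aln//; first by lia.
by have := ltn_ord i; lia.
Qed.

End LogRatio.
End Digits.

(** * Upper bounds for the dimension *)

Section UpperBoundDimension.
Context {R : realType}.
Variables (d : R) (f : nat -> R -> R) (m : nat) (t : 'I_m.+1 -> R).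
Hypothesis hf : gauss_like_ifs d f.
Hypothesis d1 : 1 < d.
Hypothesis t0 : forall i, 0 <= t i.
Hypothesis T0 : 0 < \sum_i t i.

(** Here [p < 0] is possible, so the power sums are bounded and every coding meets the criterion at
    every index. This serves [alpha = +oo]. *)
Lemma hausdorff_null_Lambda (s : R) : 1 < s * d -> 0 < s -> hausdorff_null s (Lambda f).
Proof.
move=> sd s0; pose p := (1 - s * d) / 2.
have p0 : p < 0 by rewrite /p; lra.
apply: (hausdorff_null_slow_digits hf s0 (p := p)) => //.
- exact: lt_trans ltr01.
- by rewrite lt_eqF.
- by rewrite /p; lra.
move=> K K0; exists (expR (K * (- p)^-1)); first exact: expR_gt0.
move=> x /Lambda_codes[a [x0 xa am _]]; exists a; split=> // N; exists N => //.
apply: (@le_trans _ _ (expR (K * (- p)^-1))).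
  have -> : ((a N)%:R `^ p - 1) / p = (1 - (a N)%:R `^ p) * (- p)^-1.
    by field; rewrite lt_eqF.
  rewrite ler_expR ler_wpM2l// ler_piMl ?invr_ge0 ?oppr_ge0 ?(ltW p0)// gerBl.
by rewrite ler_peMr ?expR_ge0// exprn_ege1//; lra.
Qed.

(** With [T] the sum of the [t i] and [r > 0], the condition on [s] reads [s > (1 - T / r) / d]. *)
Lemma hausdorff_null_liminf (s r : R) : 0 <= r -> 0 < s ->
  r / (\sum_i t i) * (1 - s * d) < 1 ->
  hausdorff_null s [set x | Lambda f x /\
    (limn_einf (fun n => (log_ratio f t x n)%:E) <= r%:E)%E].
Proof.
move=> r0 s0; set T := \sum_i t i; set be := r / T => bs.
have be0 : 0 <= be by rewrite divr_ge0// ltW.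
(* [p] is taken between [max 0 (1 - s * d)] and [min 1 (1 / be)]; the latter is the inverse of
   [max be 1], which also makes sense for [be = 0]. *)
have [p [p0 p1 ps bp]] : exists p, [/\ 0 < p, p < 1, 1 - s * d < p & be * p < 1].
  have sd0 : 0 < s * d by rewrite mulr_gt0// (lt_trans ltr01).
  have M0 : 0 < Num.max be 1 by rewrite lt_max ltr01 orbT.
  have M1 : 1 <= Num.max be 1 by rewrite le_max lexx orbT.
  have Mb : be <= Num.max be 1 by rewrite le_max lexx.
  set M := Num.max be 1 in M0 M1 Mb *.
  have MM : M * M^-1 = 1 by rewrite divff// gt_eqF.
  have Mi0 : 0 < M^-1 by rewrite invr_gt0.
  have [q [q0 qs qM]] : exists q, [/\ 0 <= q, 1 - s * d <= q & q < M^-1].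
    have [h|h] := leP (1 - s * d) 0; first by exists 0.
    exists (1 - s * d); split => //; first exact: ltW.
    rewrite -[_^-1]mul1r ltr_pdivlMr// mulrC /M.
    by rewrite maxEle; case: ifP => _ //; rewrite mul1r; lra.
  exists ((q + M^-1) / 2).
  have Mi1 : M^-1 <= 1 by rewrite invf_le1.
  split; [lra|lra|lra|].
  have : be * M^-1 <= 1 by rewrite -[leRHS]MM ler_wpM2r// ltW.
  have : be * q < 1.
    apply: (@le_lt_trans _ _ (M * q)); first by rewrite ler_wpM2r.
    by rewrite -[ltRHS]MM ltr_pM2l.
  lra.
(* Midway between [be] and [1 / p]: the digits satisfy [a_n <= n ^ B] infinitely often, and
   [B * p < 1] makes the [p]-th power of [a_n] negligible against [n]. *)
pose B := (be + p^-1) / 2.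
have pp : p * p^-1 = 1 by rewrite divff// gt_eqF.
have bB : be < B.
  suff : be < p^-1 by rewrite /B; lra.
  by rewrite -[p^-1]mul1r ltr_pdivlMr.
have Bp : B * p < 1 by rewrite /B mulrAC mulrDl [_^-1 * _]mulrC pp; lra.
have B0 : 0 < B by exact: le_lt_trans bB.
apply: (hausdorff_null_slow_digits hf s0 p1 _ ps); first by rewrite gt_eqF.
(* The factor [3 / 2] makes up for the index shift: the [n]-th digit is [a n.-1]. *)
move=> K K0; exists (3 / 2) => //.
move=> x [/Lambda_codes[a [x0 xa am da]] xr]; exists a; split=> // N.
have g0 : 0 < 1 - B * p by rewrite subr_gt0.
have l32 : 0 < ln (3 / 2) :> R by rewrite ln_gt0//; lra.
have [M MP] := powR_eventually_ge (K / p / ln (3 / 2)) g0.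
have rB : (r%:E < (T * B)%:E)%E.
  by rewrite lte_fin mulrC -ltr_pdivrMr.
have [n Nn] := limn_einf_frequently xr rB (maxn N (maxn M 1)).+1.
rewrite lte_fin => nB.
move: Nn; rewrite !gtn_max => /and3P[Nn Mn n1].
exists n.-1; first by rewrite -ltnS prednK// ltnW.
have a0 k : (0 < a k)%N by case: xa.
have n0 : 0 < n%:R :> R by rewrite ltr0n ltnW.
have lnn : 0 < ln n%:R :> R by rewrite ln_gt0// ltr1n.
have aB : (a n.-1)%:R <= n%:R `^ B :> R.
  rewrite -ler_ln ?posrE ?powR_gt0 ?ltr0n ?(ltnW n1)//.
  rewrite (ln_powR (n%:R : R) B) -ler_pdivrMr// -(ler_pM2l T0) mulrA.
  have /andP[h _] := log_ratio_bounds da a0 am t0 n1.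
  exact: le_trans h (ltW nB).
rewrite -exprS prednK; last exact: ltnW.
have -> : (3 / 2) ^+ n = expR (ln (3 / 2) * n%:R) :> R.
  by rewrite expRM lnK ?posrE ?powR_mulrn//; lra.
rewrite ler_expR.
apply: (@le_trans _ _ (K * ((n%:R `^ (B * p)) / p))).
  rewrite ler_wpM2l// ler_wpM2r ?invr_ge0 ?(ltW p0)// powRrM.
  apply: (@le_trans _ _ ((a n.-1)%:R `^ p)); first by rewrite gerBl.
  by apply: ge0_ler_powR; rewrite ?nnegrE ?powR_ge0// ltW.
have -> : K * (n%:R `^ (B * p) / p) = K / p * n%:R `^ (B * p) by ring.
have : K / p / ln (3 / 2) <= n%:R `^ (1 - B * p) by apply: MP; exact: ltnW.
rewrite ler_pdivrMr// => h.
apply: (le_trans (ler_wpM2r (powR_ge0 _ _) h)).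
rewrite [_ * ln _]mulrC -mulrA -powRD; last by apply/implyP => _; rewrite gt_eqF.
by rewrite subrK powRr1// ltW.
Qed.

End UpperBoundDimension.

(** * Cantor series and block digits *)

Section CantorSeries.
Context {R : realType}.
Variable N : nat -> nat.
Hypothesis N2 : forall k, (1 < N k)%N.

(** Rests of the Cantor series of [y] in [[0, 1[], rescaled to [[0, 1[]: if [e_k] is the integer
    part of [N_k] times the [k]-th rest, then [y] is the sum of the [e_k / (N_0 ... N_k)]. *)
Fixpoint cantor_rest (y : R) (k : nat) : R :=
  if k is j.+1 then (N j)%:R * cantor_rest y j - (Num.truncn ((N j)%:R * cantor_rest y j))%:R
  else y.

(** Starting from 2 keeps all digits above 1, as [codes_unique] requires. *)
Definition block_start (k : nat) : nat := (2 + \sum_(0 <= j < k) 2 * N j)%N.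

(* Only even integers are used, so that two distinct digits of the same block
   are separated by a third integer. *)
Definition block_digit (y : R) (k : nat) : nat :=
  (block_start k + 2 * Num.truncn ((N k)%:R * cantor_rest y k)%R)%N.

Lemma block_startS k : block_start k.+1 = (block_start k + 2 * N k)%N.
Proof. by rewrite /block_start big_nat_recr//= addnA. Qed.

Lemma cantor_rest_itv y k : 0 <= y < 1 -> 0 <= cantor_rest y k < 1.
Proof.
move=> y01; elim: k => //= k /andP[r0 r1]; set z := _ * _.
have z0 : 0 <= z by rewrite mulr_ge0.
by rewrite subr_ge0 truncn_le z0/= ltrBlDr addrC natr1 truncnS_gt.
Qed.

Lemma block_digit_lt y k : 0 <= y < 1 -> (block_digit y k + 2 <= block_start k.+1)%N.
Proof.
move=> /(cantor_rest_itv k)/andP[r0 r1].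
rewrite block_startS /block_digit -addnA leq_add2l.
have : (Num.truncn ((N k)%:R * cantor_rest y k) < N k)%N.
  by rewrite truncn_lt_nat ?mulr_ge0// gtr_pMr ?ltr0n ?(ltnW (N2 k)).
by lia.
Qed.

Lemma block_digit_gap y z k : (block_digit y k < block_digit z k)%N ->
  ((block_digit y k).+1 < block_digit z k)%N.
Proof. by rewrite /block_digit; lia. Qed.

Lemma block_start_gt k : (k < block_start k)%N.
Proof. by elim: k => // k IH; rewrite block_startS; have := N2 k; lia. Qed.

Lemma block_digit_gt1 y k : (1 < block_digit y k)%N.
Proof. by rewrite /block_digit /block_start; lia. Qed.

Lemma block_digit_ge y k : (k <= block_digit y k)%N.
Proof. by apply: leq_trans (ltnW (block_start_gt k)) _; exact: leq_addr. Qed.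

Lemma block_digit_monotone y k : 0 <= y < 1 -> (block_digit y k <= block_digit y k.+1)%N.
Proof.
by move=> /(block_digit_lt k) h; rewrite {2}/block_digit; lia.
Qed.

Lemma cantor_rest_sub y z n : (forall k, (k < n)%N -> block_digit y k = block_digit z k) ->
  cantor_rest y n - cantor_rest z n = (\prod_(0 <= k < n) (N k)%:R) * (y - z).
Proof.
elim: n => [|n IH] yz; first by rewrite big_geq// mul1r.
have := yz n (ltnSn n); rewrite /block_digit => e.
have {}e : Num.truncn ((N n)%:R * cantor_rest y n) = Num.truncn ((N n)%:R * cantor_rest z n).
  by lia.
rewrite big_nat_recr//= e mulrAC -IH; last by move=> k kn; apply: yz; exact: ltnW.
by ring.
Qed.

Lemma block_digit_agree y z n : 0 <= y < 1 -> 0 <= z < 1 ->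
  (forall k, (k < n)%N -> block_digit y k = block_digit z k) ->
  `|y - z| <= (\prod_(0 <= k < n) (N k)%:R)^-1.
Proof.
move=> y01 z01 /cantor_rest_sub e.
have P0 : 0 < \prod_(0 <= k < n) (N k)%:R :> R.
  by apply: prodr_gt0 => k _; rewrite ltr0n ltnW.
rewrite -[leRHS]mul1r ler_pdivlMr// mulrC -[X in X * _](gtr0_norm P0) -normrM -e.
have := cantor_rest_itv n y01; have := cantor_rest_itv n z01.
by move=> /andP[? ?] /andP[? ?]; rewrite ler_norml; apply/andP; split; lra.
Qed.

(** If all digits agreed, [|y - z|] would be at most [2 ^- n] for every [n]. *)
Lemma block_digit_neq y z : 0 <= y < 1 -> 0 <= z < 1 -> y != z ->
  exists2 n, block_digit y n != block_digit z n &
    forall k, (k < n)%N -> block_digit y k = block_digit z k.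
Proof.
move=> y01 z01 yz.
have [[n yzn]|H] := pselect (exists n, block_digit y n != block_digit z n).
  have Pex : exists n, (fun n => block_digit y n != block_digit z n) n by exists n.
  exists (ex_minn Pex); case: ex_minnP => // k yzk kmin j jk.
  by apply/eqP/negPn/negP => /kmin; rewrite leqNgt jk.
have e k : block_digit y k = block_digit z k.
  by apply/eqP/negPn/negP => h; apply: H; exists k.
have yz0 : 0 < `|y - z| by rewrite normr_gt0 subr_eq0.
have := near_infty_natSinv_expn_lt (PosNum yz0).
move=> [n _ /(_ n (leqnn n))] /=.
rewrite ltNge => /negP[].
apply: (le_trans (block_digit_agree (n := n) y01 z01 (fun k _ => e k))).
rewrite mul1r lef_pV2 ?posrE ?exprn_gt0 ?prodr_gt0//; last first.
  by move=> k _; rewrite ltr0n ltnW.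
rewrite -[X in _ ^+ X]subn0 -prodr_const_nat; apply: ler_prod => k _.
by rewrite ler0n ler_nat N2.
Qed.

End CantorSeries.

(** The finitely many exceptional indices contribute the factors [max 1 (u k / v k)] of the
    constant. *)
Lemma prod_bounded_ratio (R : realType) (u v : nat -> R) :
  (forall k, 0 < u k) -> (forall k, 0 < v k) ->
  (exists K, forall k, (K <= k)%N -> u k <= v k) ->
  exists2 A, 0 < A & forall n, \prod_(0 <= k < n) u k <= A * \prod_(0 <= k < n) v k.
Proof.
move=> u0 v0 [K KP].
pose w k := Num.max 1 (u k / v k).
have w1 k : 1 <= w k by rewrite le_max lexx.
have wv k : u k <= w k * v k by rewrite -ler_pdivrMr// le_max lexx orbT.
have w0 k : 0 <= w k := le_trans ler01 (w1 k).
exists (\prod_(0 <= k < K) w k).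
  by apply: prodr_gt0 => k _; exact: lt_le_trans (w1 k).
move=> n; apply: (@le_trans _ _ ((\prod_(0 <= k < n) w k) * \prod_(0 <= k < n) v k)).
  by rewrite -big_split/=; apply: ler_prod => k _; rewrite wv ltW.
rewrite ler_wpM2r//; first by apply: prodr_ge0 => k _; exact: ltW.
elim: n => [|n IH].
  rewrite big_geq//; elim: {KP}K => [|K IH]; first by rewrite big_geq.
  by rewrite big_nat_recr//= mulr_ege1.
have [Kn|nK] := leqP K n.
  rewrite big_nat_recr//= (_ : w n = 1) ?mulr1//.
  by apply/max_idPl; rewrite ler_pdivrMr// mul1r KP.
rewrite (big_cat_nat (leq0n n.+1) nK)/=; apply: ler_peMr; first by apply: prodr_ge0 => k _.
by elim/big_ind: _ => // a b; exact: mulr_ege1.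
Qed.

(** * Hoelder estimate for the block digit parametrization *)

Section LowerBound.
Context {R : realType}.
Variables (d : R) (f : nat -> R -> R).
Hypothesis hf : gauss_like_ifs d f.
Hypothesis d1 : 1 < d.

(** As [a k >= k], the ratios [C (a k)] are eventually at most [1/2], so their products decay
    geometrically. *)
Lemma coding_cvg_unbounded (a : nat -> nat) : (forall k, (0 < a k)%N) ->
  (forall k, (k <= a k)%N) -> cvgn (fun n => compw f (mkseq a n) 1).
Proof.
move=> a0 ak; have e0 : 0 < d / 2 by rewrite divr_gt0// (lt_trans ltr01).
have [C1 [C2 [C10 C20 C12]]] := ifs_dist_bounds hf e0.
pose C (i : nat) := C2 / i%:R `^ (d - d / 2).
have C0 i : 0 <= C i by rewrite divr_ge0 ?powR_ge0// ltW.
apply: (coding_cvg hf a0 (fun i _ => C0 i)).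
  by move=> i i0 u v u01 v01; case/andP: (C12 i i0 u v u01 v01).
have dd : 0 < d - d / 2 by lra.
have [K KP] := powR_eventually_ge (2 * C2) dd.
have CK k : (K <= k)%N -> C (a k) <= 2^-1.
  move=> Kk; rewrite /C ler_pdivrMr ?powR_gt0 ?ltr0n// -ler_pdivrMl ?invr_gt0// invrK.
  by apply: KP; exact: leq_trans (ak k).
have [|||A A0 AP] := @prod_bounded_ratio R (fun k => C (a k)) (fun=> 2^-1).
- by move=> k; rewrite divr_gt0// powR_gt0// ltr0n.
- by move=> k; rewrite invr_gt0.
- by exists K.
apply: (@squeeze_cvgr _ _ _ _ (fun=> 0) (fun n => A * 2^-1 ^+ n)).
- near=> n; rewrite big_map prodr_ge0//=.
  have := AP n; rewrite prodr_const_nat subn0 /index_iota subn0.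
  exact.
- exact: cvg_cst.
- rewrite -(mulr0 A); apply: cvgMl_tmp; apply: cvg_expr.
  by rewrite ger0_norm ?invr_ge0//; lra.
Unshelve. all: by end_near. Qed.

Lemma Lambda_coding (a : nat -> nat) : (forall k, (1 < a k)%N) ->
  (forall k, (k <= a k)%N) -> (forall k, (a k <= a k.+1)%N) ->
  Lambda f (coding_map f a) /\ forall n, digit f n (coding_map f a) = a n.-1.
Proof.
move=> a1 ak am; have a0 k : (0 < a k)%N by exact: ltnW.
have cv := coding_cvg_unbounded a0 ak.
have x01 : 0 < coding_map f a < 1.
  by have [z z01 <-] := coding_map_cylinder hf 1 a0 cv; exact: (ifs_interior hf).
have x0 : coding_map f a != 0 by rewrite gt_eqF; case/andP: x01.
have xa : codes f (coding_map f a) a by [].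
have ua b : codes f (coding_map f a) b -> a = b by exact: (codes_unique hf a1 x0 xa).
have da := digit_codes xa ua; split=> //.
split=> [|[|n] // _]; last by rewrite !da.
by split=> //; exists a; split.
Qed.

(** If [y] and [z] first differ at digit [n], then [|y - z|] is at most [1 / (N_0 ... N_(n-1))],
    while their images are at least [b 0 * ... * b n] apart. The hypothesis eventually bounds
    [1 / N_k] by the [s]-th power of [b k.+1], so the inverse map is [s]-Hoelder. *)
Lemma hausdorff_measure_block_digits (N : nat -> nat) (s : R) (A : set R) :
  (forall k, (1 < N k)%N) -> 0 <= s ->
  (exists2 e : R, 0 < e & forall C : R, 0 < C -> exists K, forall k, (K <= k)%N ->
    (block_start N k.+2)%:R `^ ((d + e) * s) <= C * (N k)%:R) ->
  (forall y : R, y \in `[0, 1[ -> A (coding_map f (block_digit N y))) ->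
  hausdorff_measure s A <> 0.
Proof.
move=> N2 s0 [e e0 eN] AN.
have [C1 [C2 [C10 C20 C12]]] := ifs_dist_bounds hf e0.
pose th := d + e; have th0 : 0 < th by rewrite addr_gt0// (lt_trans ltr01).
(* A lower bound for the contraction ratios of all integers up to the start of the next block,
   separating ones included. *)
pose b k := C1 / (block_start N k.+1)%:R `^ th.
have X0 k : 0 < (block_start N k)%:R :> R by rewrite ltr0n; exact: leq_ltn_trans (block_start_gt N2 k).
have b0 k : 0 < b k by rewrite divr_gt0 ?powR_gt0.
have Nr0 k : 0 < (N k)%:R :> R by rewrite ltr0n ltnW.
have [|||B B0 BP] := @prod_bounded_ratio R (fun k => ((N k)%:R)^-1) (fun k => b k.+1 `^ s).
- by move=> k; rewrite invr_gt0.
- by move=> k; rewrite powR_gt0.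
- have [K KP] := eN (C1 `^ s) (powR_gt0 s C10); exists K => k Kk.
  rewrite /b powRM ?invr_ge0 ?powR_ge0 ?(ltW C10)// -powRN -powRrM mulNr powRN.
  by rewrite ler_pdivlMr ?powR_gt0// mulrC ler_pdivrMr// KP.
apply: (@hausdorff_measure_neq0 _ s (B / b 0%N `^ s) (fun y => coding_map f (block_digit N y)) A) => //.
  by rewrite divr_gt0// powR_gt0.
move=> y z; rewrite !in_itv/= => y01 z01.
have [->|yz] := eqVneq y z.
  by rewrite subrr normr0 mulr_ge0 ?powR_ge0// divr_ge0 ?powR_ge0// ltW.
have [n yzn agree] := block_digit_neq N2 y01 z01 yz.
apply: (le_trans (block_digit_agree N2 y01 z01 agree)).
have prodV : (\prod_(0 <= k < n) (N k)%:R)^-1 = \prod_(0 <= k < n) ((N k)%:R)^-1 :> R.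
  by rewrite prodfV.
rewrite prodV; apply: (le_trans (BP n)).
(* The index shift supplies the factor for the digit [n], where the points separate; the extra [b 0]
   goes into the Hoelder constant. *)
have -> : \prod_(0 <= k < n) b k.+1 `^ s = (\prod_(0 <= k < n.+1) b k) `^ s / b 0%N `^ s.
  rewrite powR_prod; last by move=> k; exact: ltW.
  by rewrite [in RHS]big_nat_recl//= mulrAC divff ?mul1r// gt_eqF// powR_gt0.
rewrite mulrA mulrAC ler_wpM2l//; first by rewrite divr_ge0 ?powR_ge0// ltW.
have P0 : 0 <= \prod_(0 <= k < n.+1) b k by apply: prodr_ge0 => k _; exact: ltW.
apply: ge0_ler_powR; rewrite ?nnegrE// {P0}.
wlog lt_yz : y z y01 z01 yz yzn agree / (block_digit N y n < block_digit N z n)%N.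
  move=> H; have [h|h] := leqP (block_digit N z n) (block_digit N y n); last exact: H.
  rewrite distrC; apply: H => //; [by rewrite eq_sym|by rewrite eq_sym|by move=> k /agree|].
  by rewrite ltn_neqAle eq_sym yzn.
pose c (i : nat) := C1 / i%:R `^ th.
have c0 i : (0 < i)%N -> 0 <= c i by move=> i0; rewrite divr_ge0 ?powR_ge0// ltW.
have cb k i : (0 < i)%N -> (i <= block_start N k.+1)%N -> b k <= c i.
  move=> i0 ik; apply: ler_wpM2l; first exact: ltW.
  have i0' : 0 < i%:R :> R by rewrite ltr0n.
  rewrite lef_pV2 ?posrE; [|exact: powR_gt0 th (X0 k.+1)|exact: powR_gt0].
  by apply: ge0_ler_powR; rewrite ?nnegrE ?ler0n ?ler_nat// ltW.
set a := block_digit N y; set a' := block_digit N z.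
have cyl_code (u : R) : 0 <= u < 1 ->
    cylinder f (mkseq (block_digit N u) n.+1) (coding_map f (block_digit N u)).
  move=> u01; have g0 k : (0 < block_digit N u k)%N by exact: ltnW (block_digit_gt1 _ _ _).
  apply: (coding_map_cylinder hf) => //; apply: coding_cvg_unbounded => // k.
  exact: block_digit_ge.
have [u u01 <-] := cyl_code y y01; have [v v01 <-] := cyl_code z z01.
rewrite -/a -/a'.
have a0 k : (0 < a k)%N by exact: ltnW (block_digit_gt1 _ _ _).
have a'0 k : (0 < a' k)%N by exact: ltnW (block_digit_gt1 _ _ _).
have mkS (g : nat -> nat) : mkseq g n.+1 = mkseq g n ++ [:: g n].
  by rewrite -[n.+1]addn1 mkseqD [X in _ ++ X]/mkseq /= addn0.
have aa' : mkseq a' n = mkseq a n.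
  by apply/eq_in_map => k; rewrite mem_iota add0n => /andP[_ kn]; exact: esym (agree k kn).
rewrite !mkS aa' !compw_cat.
have fC i : (0 < i)%N -> forall u v, u \in `[0, 1] -> v \in `[0, 1] ->
    c i * `|u - v| <= `|f i u - f i v| <= C2 / i%:R `^ (d - e) * `|u - v|.
  by move=> i0 p q p01 q01; exact: C12.
have /andP[h _] := compw_dist hf c0 (fun i _ => divr_ge0 (ltW C20) (powR_ge0 _ _)) fC
  (positive_mkseq n a0) (ifs_in hf (a0 n) u01) (ifs_in hf (a'0 n) v01).
apply: le_trans h.
rewrite big_nat_recr//= big_map /index_iota subn0; apply: ler_pM.
- by apply: prodr_ge0 => k _; exact: ltW.
- exact: ltW.
- apply: ler_prod => k _; rewrite (ltW (b0 k)) cb//.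
  exact: leq_trans (leq_addr 2 _) (block_digit_lt N2 k y01).
rewrite distrC.
apply: (@le_trans _ _ (c (a n).+1)).
  apply: cb => //; apply: ltnW; rewrite -addn2; exact: (block_digit_lt N2 n y01).
(* Digits of a block have the same parity, so [(a n).+1] lies strictly between [a n] and [a' n]. *)
apply: (ifs_gap hf (l := (a n).+1) (a0 n)) => //.
  exact: block_digit_gap.
by move=> p q p01 q01; case/andP: (fC (a n).+1 isT p q p01 q01).
Qed.

End LowerBound.

Lemma ln_eventually_ge (R : realType) (K : R) :
  exists N, forall n, (N <= n)%N -> K <= ln n%:R.
Proof.
have [N NP] := powR_eventually_ge (expR K) (@ltr01 R).
exists N.+1 => n Nn; rewrite -ler_expR lnK ?posrE ?ltr0n ?(leq_trans _ Nn)//.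
by rewrite -[leRHS]powRr1//; apply: NP; exact: ltnW.
Qed.

(** * Blocks of polynomial length *)

Section PolynomialBlocks.
Context {R : realType}.
Variable be : R.
Hypothesis be1 : 1 < be.

(** Adding 2 makes up for the truncation and guarantees values above 1. *)
Definition poly_block (k : nat) : nat := (Num.truncn (k.+1%:R `^ (be - 1)) + 2)%N.

Let be0 : 0 < be. Proof. exact: lt_trans be1. Qed.
Let be10 : 0 < be - 1. Proof. by rewrite subr_gt0. Qed.

Let powR_mono (p x y : R) : 0 < p -> 0 <= x -> x <= y -> x `^ p <= y `^ p.
Proof.
by move=> p0 x0 xy; apply: ge0_ler_powR; rewrite ?nnegrE ?(ltW p0)// (le_trans x0).
Qed.

Let powR_nat_ge1 (p : R) k : 0 < p -> 1 <= k.+1%:R `^ p :> R.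
Proof.
by move=> p0; rewrite -[leLHS](powRr0 (k.+1%:R : R)); apply: ler_powR; [rewrite ler1n | exact: ltW].
Qed.

Let powR_split (x : R) : 0 < x -> x * x `^ (be - 1) = x `^ be.
Proof. by move=> x0; rewrite mulr_powRB1 ?(ltW x0). Qed.

Lemma poly_block_gt1 k : (1 < poly_block k)%N.
Proof. by rewrite /poly_block addn2. Qed.

Lemma poly_block_ge k : k.+1%:R `^ (be - 1) <= (poly_block k)%:R :> R.
Proof.
by apply: (le_trans (ltW (truncnS_gt _))); rewrite ler_nat /poly_block addn2.
Qed.

Lemma poly_block_le k : (poly_block k)%:R <= 3 * k.+1%:R `^ (be - 1) :> R.
Proof.
have h1 := powR_nat_ge1 k be10.
have : (Num.truncn (k.+1%:R `^ (be - 1) : R))%:R <= k.+1%:R `^ (be - 1) :> R.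
  by rewrite truncn_le powR_ge0.
rewrite /poly_block natrD; lra.
Qed.

(** The [k] blocks have length at most [6 * k ^ (be - 1)] each; the initial value 2 accounts for the
    rest of the constant 8. *)
Lemma block_start_poly_le k : (0 < k)%N ->
  (block_start poly_block k)%:R <= 8 * k%:R `^ be :> R.
Proof.
move=> k0; have kr0 : 0 < k%:R :> R by rewrite ltr0n.
rewrite /block_start natrD natr_sum.
have : \sum_(0 <= j < k) (2 * poly_block j)%:R <= \sum_(0 <= j < k) 6 * k%:R `^ (be - 1) :> R.
  rewrite big_nat [leRHS]big_nat; apply: ler_sum => j /andP[_ jk].
  rewrite natrM; apply: (le_trans (ler_wpM2l _ (poly_block_le j))) => //.
  rewrite mulrA (_ : 2 * 3 = 6 :> R); last by ring.
  by rewrite ler_wpM2l// powR_mono// ler_nat.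
have -> : \sum_(0 <= j < k) 6 * k%:R `^ (be - 1) = 6 * k%:R `^ be :> R.
  by rewrite sumr_const_nat subn0 -[LHS]mulr_natr -mulrA [X in 6 * X]mulrC powR_split.
move=> h.
have : 1 <= k%:R `^ be :> R by case: k k0 {kr0 h} => // k _; exact: powR_nat_ge1.
lra.
Qed.

(** The blocks from [k / 2] on suffice: there are at least [k / 2] of them, each of length at least
    [(k / 2) ^ (be - 1)]. *)
Lemma block_start_poly_ge k : (0 < k)%N ->
  (k.+1%:R / 4) `^ be <= (block_start poly_block k)%:R :> R.
Proof.
move=> k0; have kr0 : 0 < k%:R / 2 :> R by rewrite divr_gt0// ltr0n.
have k1 : 1 <= k%:R :> R by rewrite ler1n.
apply: (@le_trans _ _ ((k%:R / 2) `^ be)).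
  by apply: powR_mono => //; rewrite -natr1; lra.
have hk : k%:R <= 2 * (k - k./2)%:R :> R.
  by rewrite -natrM ler_nat; have := odd_double_half k; lia.
have hk2 : k%:R / 2 <= k./2.+1%:R :> R.
  by rewrite ler_pdivrMr// -natrM ler_nat; have := odd_double_half k; lia.
have kk : (k./2 <= k)%N by have := odd_double_half k; lia.
rewrite /block_start natrD natr_sum (big_cat_nat (leq0n k./2) kk)/=.
have : \sum_(k./2 <= j < k) (k%:R / 2) `^ (be - 1) <=
    \sum_(k./2 <= j < k) (2 * poly_block j)%:R :> R.
  rewrite big_nat [leRHS]big_nat; apply: ler_sum => j /andP[kj _].
  apply: (@le_trans _ _ (poly_block j)%:R); last by rewrite ler_nat; lia.
  apply: le_trans (poly_block_ge j); apply: powR_mono => //.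
  by apply: (le_trans hk2); rewrite ler_nat.
rewrite sumr_const_nat -[X in X <= _ -> _]mulr_natl => h.
have : k%:R / 2 * (k%:R / 2) `^ (be - 1) <= (k - k./2)%:R * (k%:R / 2) `^ (be - 1) :> R.
  by apply: ler_wpM2r; [exact: powR_ge0 | lra].
rewrite powR_split// => h2.
have : 0 <= \sum_(0 <= i < k./2) (2 * poly_block i)%:R :> R by apply: sumr_ge0.
lra.
Qed.

(** The sides have orders [k ^ (be * g)] and [k ^ (be - 1)]. With [g = (d + e) * s] this is what
    [hausdorff_measure_block_digits] asks for. *)
Lemma block_start_poly_eventually_le (g C : R) : 0 <= g -> be * g < be - 1 -> 0 < C ->
  exists K, forall k, (K <= k)%N ->
    (block_start poly_block k.+2)%:R `^ g <= C * (poly_block k)%:R.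
Proof.
move=> g0 gb C0.
have h0 : 0 < be - 1 - be * g by rewrite subr_gt0.
have [K KP] := powR_eventually_ge ((8 * 2 `^ be) `^ g / C) h0; exists K => k Kk.
have k1 : 0 < k.+1%:R :> R by rewrite ltr0n.
apply: (@le_trans _ _ ((8 * 2 `^ be * k.+1%:R `^ be) `^ g)).
  apply: ge0_ler_powR; rewrite ?nnegrE// ?mulr_ge0 ?powR_ge0//.
  apply: (le_trans (block_start_poly_le (ltn0Sn k.+1))).
  rewrite -mulrA ler_wpM2l// -powRM//; apply: powR_mono => //.
  by rewrite -natrM ler_nat; lia.
rewrite powRM ?mulr_ge0 ?powR_ge0// -powRrM.
apply: (@le_trans _ _ (C * k.+1%:R `^ (be - 1))); last first.
  by rewrite ler_wpM2l ?(ltW C0)// poly_block_ge.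
have -> : be - 1 = be - 1 - be * g + be * g by rewrite subrK.
rewrite powRD; last by apply/implyP => _; rewrite gt_eqF.
rewrite mulrA ler_wpM2r ?powR_ge0// [C * _]mulrC -ler_pdivrMr//.
by apply: KP; exact: leqW.
Qed.

End PolynomialBlocks.

(** * Blocks of exponential length *)

Definition exp_block (k : nat) : nat := (4 ^ k.+1)%N.

Lemma exp_block_gt1 k : (1 < exp_block k)%N.
Proof. by rewrite /exp_block expnS; have := expn_gt0 4 k; lia. Qed.

Lemma block_start_exp_le k : (block_start exp_block k <= 4 ^ k.+1)%N.
Proof.
elim: k => [|k IH]; first by rewrite /block_start big_geq.
by rewrite block_startS -[exp_block k]/(4 ^ k.+1)%N [leqRHS]expnS; lia.
Qed.

Lemma block_start_exp_ge k : (4 ^ k <= block_start exp_block k)%N.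
Proof.
case: k => [|k]; first by rewrite /block_start big_geq.
by rewrite block_startS -[exp_block k]/(4 ^ k.+1)%N; lia.
Qed.

Lemma block_start_exp_eventually_le (R : realType) (g C : R) : 0 <= g -> g < 1 -> 0 < C ->
  exists K, forall k, (K <= k)%N ->
    (block_start exp_block k.+2)%:R `^ g <= C * (exp_block k)%:R.
Proof.
move=> g0 g1 C0; have g10 : 0 < 1 - g by rewrite subr_gt0.
have [K KP] := powR_eventually_ge (16 `^ g / C) g10; exists K => k Kk.
have e0 : 0 < (exp_block k)%:R :> R by rewrite ltr0n expn_gt0.
(* [block_start exp_block k.+2] is at most [4 ^ k.+3], which is 16 times [exp_block k]. *)
apply: (@le_trans _ _ ((16 * (exp_block k)%:R) `^ g)).
  apply: ge0_ler_powR; rewrite ?nnegrE// -natrM ler_nat /exp_block.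
  by apply: (leq_trans (block_start_exp_le _)); rewrite -(expnD 4 2).
rewrite powRM//.
have -> : C * (exp_block k)%:R = C * (exp_block k)%:R `^ (1 - g) * (exp_block k)%:R `^ g.
  rewrite -mulrA -powRD; last by apply/implyP => _; rewrite gt_eqF.
  by rewrite subrK powRr1// ltW.
rewrite ler_wpM2r ?powR_ge0// mulrC -ler_pdivrMr//; apply: KP.
by apply: (leq_trans Kk); apply: ltnW; apply: ltn_trans (ltnSn k) _; exact: ltn_expl.
Qed.

(** * Lower bounds for the dimension and comparison with the upper ones *)

Section LowerBoundDimension.
Context {R : realType}.
Variables (d : R) (f : nat -> R -> R) (m : nat) (t : 'I_m.+1 -> R).
Hypothesis hf : gauss_like_ifs d f.
Hypothesis d1 : 1 < d.
Hypothesis t0 : forall i, 0 <= t i.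
Hypothesis T0 : 0 < \sum_i t i.

Lemma exists_small (c D : R) : 0 <= c -> 0 < D -> exists2 e, 0 < e & c * e < D.
Proof.
move=> c0 D0; have c1 : 0 < c + 1 by rewrite ltr_wpDl.
exists (D / (c + 1)); first exact: divr_gt0.
by rewrite mulrA ltr_pdivrMr// mulrC ltr_pM2l// ltrDl.
Qed.

Lemma log_ratio_block_bounds (N : nat -> nat) (y : R) : (forall k, (1 < N k)%N) ->
  y \in `[0, 1[ -> let x := coding_map f (block_digit N y) in
  Lambda f x /\ forall n, (1 < n)%N ->
  (\sum_i t i) * ln (block_start N n.-1)%:R / ln n%:R <= log_ratio f t x n <=
  (\sum_i t i) * ln (block_start N (n + m))%:R / ln n%:R.
Proof.
move=> N2 y01 x; rewrite in_itv/= in y01.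
have a1 := block_digit_gt1 N y.
have ak := block_digit_ge N2 y.
have am k := block_digit_monotone N2 k y01.
have [xL da] := Lambda_coding hf d1 a1 ak am; split=> // n n1.
have a0 k : (0 < block_digit N y k)%N by exact: ltnW.
have X0 k : (0 < block_start N k)%N by exact: leq_ltn_trans (block_start_gt N2 k).
have ln0 : 0 <= (ln n%:R)^-1 :> R by rewrite invr_ge0 ln_ge0// ler1n ltnW.
have /andP[h1 h2] := log_ratio_bounds da a0 am t0 n1; apply/andP; split.
  apply: le_trans h1; rewrite ler_wpM2r// ler_wpM2l ?(ltW T0)//.
  rewrite ler_ln ?posrE ?ltr0n// ler_nat; exact: leq_addr.
apply: (le_trans h2); rewrite ler_wpM2r// ler_wpM2l ?(ltW T0)//.
rewrite ler_ln ?posrE ?ltr0n// ler_nat.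
have := block_digit_lt N2 (n + m).-1 y01; rewrite prednK; last by rewrite addn_gt0 ltnW.
by move=> h; apply: leq_trans h; exact: leq_addr.
Qed.

Lemma cvg_log_scale (u : nat -> R) (r c : R) :
  (forall n, (1 < n)%N -> `|u n - r| <= c / ln n%:R) ->
  (fun n => (u n)%:E) @ \oo --> r%:E.
Proof.
move=> uc; apply: cvg_EFin; first exact: nearW.
apply/cvgrPdist_le => e e0; have [K KP] := ln_eventually_ge (c / e).
exists (maxn K 2) => // n /=; rewrite geq_max => /andP[Kn n1].
rewrite distrC; apply: (le_trans (uc n n1)).
by rewrite ler_pdivrMr ?ln_gt0 ?ltr1n// mulrC -ler_pdivrMr// KP.
Qed.

(** [block_start k] lies between constant multiples of [k ^ be], so the logarithm of the [n]-th
    digit differs from [be * ln n] by a bounded amount. *)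
Lemma F_set_poly_block (be y : R) : 1 < be -> y \in `[0, 1[ ->
  F_set f (Lambda f) ((\sum_i t i) * be)%:E t (coding_map f (block_digit (poly_block be) y)).
Proof.
move=> be1 y01; have be0 : 0 < be := lt_trans ltr01 be1.
have N2 := poly_block_gt1 be.
have [xL xb] := log_ratio_block_bounds N2 y01; split=> //.
move: T0 xb; set T := \sum_i t i => T_gt0 xb.
(* The 4 comes from [block_start_poly_ge], the 8 from [block_start_poly_le], and [m.+1] from
   [n + m <= m.+1 * n]. *)
apply: (@cvg_log_scale _ _ (T * be * ln 4 + T * ln 8 + T * be * ln m.+1%:R)) => n n1.
have /andP[h1 h2] := xb n n1.
have lnn : 0 < ln n%:R :> R by rewrite ln_gt0// ltr1n.
have n0 : 0 < n%:R :> R by rewrite ltr0n ltnW.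
have X0 k : 0 < (block_start (poly_block be) k)%:R :> R.
  by rewrite ltr0n; exact: leq_ltn_trans (block_start_gt N2 k).
have l4 : 0 <= ln 4 :> R by apply: ln_ge0; lra.
have l8 : 0 <= ln 8 :> R by apply: ln_ge0; lra.
have lm : 0 <= ln m.+1%:R :> R by apply: ln_ge0; rewrite ler1n.
have Tb : 0 <= T * be by rewrite mulr_ge0 ?ltW.
have low : be * (ln n%:R - ln 4) <= ln (block_start (poly_block be) n.-1)%:R.
  have -> : be * (ln n%:R - ln 4) = ln ((n%:R / 4) `^ be) by rewrite ln_powR ln_div ?posrE.
  rewrite ler_ln ?posrE ?powR_gt0 ?divr_gt0//.
  have := block_start_poly_ge be1 (k := n.-1); rewrite prednK; last exact: ltnW.
  by apply; rewrite -ltnS prednK// ltnW.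
have up : ln (block_start (poly_block be) (n + m))%:R <= ln 8 + be * (ln m.+1%:R + ln n%:R).
  have m0 : 0 < m.+1%:R :> R by rewrite ltr0n.
  have mn0 : 0 < (m.+1%:R * n%:R) `^ be by rewrite powR_gt0// mulr_gt0.
  have -> : ln 8 + be * (ln m.+1%:R + ln n%:R) = ln (8 * (m.+1%:R * n%:R) `^ be) :> R.
    by rewrite lnM ?posrE// ln_powR lnM ?posrE.
  rewrite ler_ln ?posrE ?mulr_gt0//.
  apply: (le_trans (block_start_poly_le be1 (_ : 0 < n + m)%N)); first by rewrite addn_gt0 ltnW.
  rewrite ler_wpM2l//; apply: ge0_ler_powR; rewrite ?nnegrE ?(ltW be0)//.
  by rewrite -natrM ler_nat mulSn leq_add2l leq_pmulr// ltnW.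
rewrite ler_pdivlMr// -[ln n%:R](gtr0_norm lnn) -normrM mulrBl.
rewrite ler_pdivrMr// in h1; rewrite ler_pdivlMr// in h2.
have {}low := le_trans (ler_wpM2l (ltW T_gt0) low) h1.
have {}up := le_trans h2 (ler_wpM2l (ltW T_gt0) up).
have p4 := mulr_ge0 Tb l4; have p8 := mulr_ge0 (ltW T_gt0) l8; have pm := mulr_ge0 Tb lm.
by rewrite ler_norml; apply/andP; split; nra.
Qed.

Lemma F_set_exp_block (y : R) : y \in `[0, 1[ ->
  F_set f (Lambda f) +oo%E t (coding_map f (block_digit exp_block y)).
Proof.
move=> y01; have [xL xb] := log_ratio_block_bounds exp_block_gt1 y01; split=> //.
move: T0 xb; set T := \sum_i t i => T_gt0 xb.
apply/cvgeyPge => A.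
have l4 : 0 < ln 4 :> R by apply: ln_gt0; lra.
have h0 : 0 < 2^-1 :> R by rewrite invr_gt0.
(* With [z] the square root of [n], this gives [4 * |A| <= T * ln 4 * z]; as [ln n <= 2 * z], the
   product [|A| * ln n] is at most [T * ln 4 * n / 2]. *)
have [K KP] := powR_eventually_ge (4 * `|A| / (T * ln 4)) h0.
exists (maxn K 2) => // n /=; rewrite geq_max => /andP[Kn n1]; rewrite lee_fin.
have /andP[h1 _] := xb n n1; apply: le_trans h1.
have lnn : 0 < ln n%:R :> R by rewrite ln_gt0// ltr1n.
have n0 : 0 < n%:R :> R by rewrite ltr0n ltnW.
rewrite ler_pdivlMr//.
have low : n.-1%:R * ln 4 <= ln (block_start exp_block n.-1)%:R :> R.
  have X0 : 0 < (block_start exp_block n.-1)%:R :> R.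
    by rewrite ltr0n; exact: leq_ltn_trans (block_start_gt exp_block_gt1 n.-1).
  rewrite mulrC mulr_natr -lnXn// ler_ln ?posrE ?exprn_gt0//.
  by rewrite -natrX ler_nat block_start_exp_ge.
apply: le_trans (ler_wpM2l (ltW T_gt0) low).
have hn : n%:R / 2 <= n.-1%:R :> R.
  by rewrite ler_pdivrMr// -natrM ler_nat; lia.
have sq : n%:R `^ 2^-1 * n%:R `^ 2^-1 = n%:R :> R.
  rewrite -powRD; last by apply/implyP => _; rewrite gt_eqF.
  by rewrite (_ : 2^-1 + 2^-1 = 1 :> R) ?powRr1 ?ltW//; field.
have ls : ln n%:R <= 2 * n%:R `^ 2^-1 :> R.
  have := ltW (ln_sublinear (powR_gt0 2^-1 n0)); rewrite ln_powR; lra.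
have := KP n Kn; rewrite ler_pdivrMr ?mulr_gt0// => KA.
set z := n%:R `^ 2^-1 in sq ls KA.
have z0 : 0 <= z by exact: powR_ge0.
have Tl : 0 < T * ln 4 by rewrite mulr_gt0.
apply: (@le_trans _ _ (`|A| * (2 * z))).
  apply: (le_trans (ler_wpM2r (ltW lnn) (ler_norm A))).
  by rewrite ler_wpM2l.
apply: (@le_trans _ _ (T * ln 4 * (n%:R / 2))).
  have := ler_wpM2r z0 KA; rewrite -sq; lra.
by have := ler_wpM2l (ltW Tl) hn; lra.
Qed.

(** The condition on [s] reads [s < (1 - 1 / be) / d]; being strict, it survives replacing [d] by
    [d + e] for a small [e]. *)
Lemma hausdorff_measure_F_set_finite (s r : R) : 0 <= s ->
  let be := r / (\sum_i t i) in 1 < be -> be * (s * d) < be - 1 ->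
  hausdorff_measure s (F_set f (Lambda f) r%:E t) <> 0.
Proof.
move=> s0 be be1 bs.
have rE : r = (\sum_i t i) * be by rewrite /be mulrC divfK// gt_eqF.
have be0 : 0 < be := lt_trans ltr01 be1.
have D0 : 0 < be - 1 - be * (s * d) by rewrite subr_gt0.
have [e e0 eD] := exists_small (mulr_ge0 (ltW be0) s0) D0.
apply: (hausdorff_measure_block_digits hf d1 (poly_block_gt1 be)) => //; last first.
  by move=> y y01; rewrite rE; exact: F_set_poly_block.
exists e => // C C0; apply: block_start_poly_eventually_le => //.
  by rewrite mulr_ge0// addr_ge0 ?(ltW e0)// (le_trans ler01)// ltW.
by rewrite mulrDl mulrDr [d * s]mulrC [e * s]mulrC; move: eD; rewrite mulrA; lra.
Qed.

Lemma hausdorff_measure_F_set_infinite (s : R) : 0 <= s -> s * d < 1 ->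
  hausdorff_measure s (F_set f (Lambda f) +oo%E t) <> 0.
Proof.
move=> s0 sd; have D0 : 0 < 1 - s * d by rewrite subr_gt0.
have [e e0 eD] := exists_small s0 D0.
apply: (hausdorff_measure_block_digits hf d1 exp_block_gt1) => //; last first.
  by move=> y y01; exact: F_set_exp_block.
exists e => // C C0; apply: block_start_exp_eventually_le => //.
  by rewrite mulr_ge0// addr_ge0 ?(ltW e0)// (le_trans ler01)// ltW.
by rewrite mulrDl [d * s]mulrC [e * s]mulrC; lra.
Qed.

(** If [F_set] is null in dimension [s], the lower bound shows that [s] is at least the critical
    exponent; every [u > s] then exceeds it, and the upper bound applies. *)
Lemma hausdorff_dim_liminf_le (alpha : \bar R) : (0 <= alpha)%E ->
  (hausdorff_dim [set x | Lambda f x /\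
     (limn_einf (fun n => (log_ratio f t x n)%:E) <= alpha)%E] <=
   hausdorff_dim (F_set f (Lambda f) alpha t))%E.
Proof.
move=> al0; apply: hausdorff_dim_le => s u s0 su Fs0.
have u0 : 0 < u by exact: le_lt_trans su.
have d0 : 0 < d := lt_trans ltr01 d1.
have sud : s * d < u * d by rewrite ltr_pM2r.
apply: hausdorff_null_measure => //.
case: alpha al0 Fs0 => [r| |] // r0 Fs0.
  apply: (hausdorff_null_liminf hf d1 t0 T0 _ u0); first by rewrite -lee_fin.
  have := hausdorff_measure_F_set_finite s0 (r := r).
  have be0 : 0 <= r / (\sum_i t i) by rewrite divr_ge0// ltW.
  set be := r / _ in be0 *; move=> /= H.
  (* For [be <= 1] the critical exponent is 0, and [u > 0] is enough. *)
  have [be1|be1] := leP be 1; last first.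
    have : be - 1 <= be * (s * d) by rewrite leNgt; apply/negP => h; exact: (H be1 h).
    by have := ltr_pM2l (lt_trans ltr01 be1) (s * d) (u * d); rewrite sud; nra.
  have ud : 0 < u * d by rewrite mulr_gt0.
  have [->|bne] := eqVneq be 0; first by rewrite mul0r.
  have bgt : 0 < be by rewrite lt0r bne.
  have := mulr_gt0 bgt ud; lra.
apply: (hausdorff_null_sub (B := Lambda f)); first by move=> x [].
apply: (hausdorff_null_Lambda hf) => //; apply: le_lt_trans sud.
by rewrite leNgt; apply/negP => h; exact: (hausdorff_measure_F_set_infinite s0 h).
Qed.

End LowerBoundDimension.

(** * Equality of the three dimensions *)

Unset Implicit Arguments.
Set Strict Implicit.

Theorem theorem1p9 (R : realType) (d : R) (hd : 1 < d)
  (f : nat -> R -> R) (hf : gauss_like_ifs d f)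
  (m : nat) (hm : (1 <= m)%N) (t : 'I_m.+1 -> R)
  (ht : forall i, 0 <= t i) (ht0 : t ord0 != 0)
  (hti : exists i : 'I_m.+1, (1 <= i)%N /\ t i != 0)
  (alpha : \bar R) (halpha : (0 <= alpha)%E) :
  hausdorff_dim (F_set f (Lambda f) alpha t) =
    hausdorff_dim (G_set f (Lambda f) alpha t) /\
  hausdorff_dim (G_set f (Lambda f) alpha t) =
    hausdorff_dim (E_set f (Lambda f) alpha t).
Proof.
have T0 : 0 < \sum_i t i.
  by rewrite big_ord_recl ltr_wpDr ?sumr_ge0// lt0r ht0 ht.
pose U := [set x | Lambda f x /\
  (limn_einf (fun n => (log_ratio f t x n)%:E) <= alpha)%E].
have UF : (hausdorff_dim U <= hausdorff_dim (F_set f (Lambda f) alpha t))%E.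
  exact: (hausdorff_dim_liminf_le hf hd ht T0 halpha).
have FG : F_set f (Lambda f) alpha t `<=` G_set f (Lambda f) alpha t.
  by move=> x [xL /cvg_limn_einf_sup[_ xF]]; split.
have FE : F_set f (Lambda f) alpha t `<=` E_set f (Lambda f) alpha t.
  by move=> x [xL /cvg_limn_einf_sup[xF _]]; split.
have GU : G_set f (Lambda f) alpha t `<=` U.
  by move=> x [xL xG]; split => //; rewrite -xG; exact: limn_einf_sup.
have EU : E_set f (Lambda f) alpha t `<=` U by move=> x [xL xE]; split => //; rewrite xE.
have dimE A : F_set f (Lambda f) alpha t `<=` A -> A `<=` U ->
    hausdorff_dim (F_set f (Lambda f) alpha t) = hausdorff_dim A.
  move=> FA AU; apply/eqP; rewrite eq_le le_hausdorff_dim//=.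
  exact: le_trans (le_hausdorff_dim AU) UF.
by rewrite -!dimE.
Qed.
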